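(* Let $z>0$ and $\gamma\in\mathbb R$, let $n$ be even, and let $\kappa,u,r,p,q,C_{n,k},S_n,A,B,\mathcal H,d$ be as defined in the context. For integers $m\ge0$ define $$\mu_m(z,\gamma):=\int_{-\infty}^{\infty}x^m\exp\!\left(\gamma x^2-\frac{B(z)}{12}x^4\right)dx .$$ Then, as $n\to\infty$ through even integers, $$S_n=C_{n,\kappa}\,n^{3/4}\,\mu_0(z,\gamma)\,(1+o(1)),$$ and hence $$S_n=d(z)\,\mu_0(z,\gamma)\,n^{1/4}\exp\!\left(n\mathcal H(z)-\frac{un}{4}\right)(1+o(1)).$$ Moreover, for every integer $m\ge0$, $$\frac1{S_n}\sum_{k=0}^{n}\left(\frac{k-\kappa}{n^{3/4}}\right)^mC_{n,k}\longrightarrow\frac{\mu_m(z,\gamma)}{\mu_0(z,\gamma)} .$$ For odd $m$, the left-hand side is already zero.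
   Context: For $0\le k\le n$, the $(p,q)$-binomial coefficient is $$\binom{n}{k}_{p,q}:=\prod_{j=1}^{k}\frac{p^{\,n-k+j}-q^{\,n-k+j}}{p^j-q^j}.$$ For $z>0$ define $$A(z):=z\left(\coth\frac z4-1\right),\qquad B(z):=\frac{z^3\sinh(z/2)}{8\sinh^4(z/4)}>0,$$ $$\mathcal H(z):=\frac{\mathrm{Li}_2(e^{-z})-2\,\mathrm{Li}_2(e^{-z/2})+\pi^2/6}{z},\qquad d(z):=\left(\frac{z(1-e^{-z})}{2\pi(1-e^{-z/2})^2}\right)^{1/2},$$ where $\mathrm{Li}_2(x)=\sum_{k\ge1}x^k/k^2$ is the dilogarithm. For an even positive integer $n$, put $$\kappa:=\frac n2,\quad r:=e^{-z/n},\quad u:=\frac{A(z)}2+\frac{\gamma}{\sqrt n},\quad p:=e^{-u/n},\quad q:=pr=e^{-(u+z)/n},$$ $$C_{n,k}:=\binom{n}{k}_{p,q},\qquad S_n:=\sum_{k=0}^nC_{n,k}.$$ *)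

(* Defs.v *)
From HB Require Import structures.
From mathcomp Require Import all_boot all_order all_algebra.
From mathcomp Require Import all_classical all_reals all_analysis.
Import Order.TTheory GRing.Theory Num.Theory.
Import numFieldNormedType.Exports.

Set Implicit Arguments.
Unset Strict Implicit.
Unset Printing Implicit Defensive.

Local Open Scope classical_set_scope.
Local Open Scope ring_scope.

(* The filter of "n tends to infinity through even integers". *)
Definition even_oo : set_system nat := within [set n | ~~ odd n] \oo.

Global Instance even_oo_filter : Filter even_oo.
Proof. exact: within_filter. Qed.

Canonical even_oo_filter_on := FilterType even_oo even_oo_filter.

Section Defs.
Variable R : realType.
Implicit Types (p q x z gamma : R) (n k m : nat).

(* Intended for k <= n, where the subtraction n - k is not truncated. *)
Definition pqbinom p q n k : R :=
  \prod_(1 <= j < k.+1)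
    ((p ^+ (n - k + j) - q ^+ (n - k + j)) / (p ^+ j - q ^+ j)).

Definition sinh x : R := (expR x - expR (- x)) / 2.
Definition cosh x : R := (expR x + expR (- x)) / 2.
Definition coth x : R := cosh x / sinh x.

(* The limit of partial sums exists for `|x| <= 1, the only range used. *)
Definition Li2 x : R := limn (fun N => \sum_(1 <= k < N.+1) (x ^+ k / k%:R ^+ 2)).

Definition Afun z : R := z * (coth (z / 4) - 1).

Definition Bfun z : R := z ^+ 3 * sinh (z / 2) / (8 * sinh (z / 4) ^+ 4).

Definition Hfun z : R :=
  (Li2 (expR (- z)) - 2 * Li2 (expR (- z / 2)) + pi ^+ 2 / 6) / z.

Definition dfun z : R :=
  (z * (1 - expR (- z)) / (2 * pi * (1 - expR (- z / 2)) ^+ 2)) `^ (1 / 2).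

Definition kappa n : nat := n./2.

Definition r_ z n : R := expR (- z / n%:R).

Definition u_ z gamma n : R := Afun z / 2 + gamma / Num.sqrt n%:R.

Definition p_ z gamma n : R := expR (- u_ z gamma n / n%:R).

Definition q_ z gamma n : R := p_ z gamma n * r_ z n.

Definition C_ z gamma n k : R := pqbinom (p_ z gamma n) (q_ z gamma n) n k.

Definition S_ z gamma n : R := \sum_(0 <= k < n.+1) C_ z gamma n k.

Definition mu_ m z gamma : R :=
  \int[@lebesgue_measure R]_x
    (x ^+ m * expR (gamma * x ^+ 2 - Bfun z / 12 * x ^+ 4)).

Definition scaled_moment m z gamma n : R :=
  1 / S_ z gamma n *
  \sum_(0 <= k < n.+1)
    ((k%:R - (kappa n)%:R) / n%:R `^ (3 / 4)) ^+ m * C_ z gamma n k.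

End Defs.

(* Main.v *)
Require Import Defs.
From HB Require Import structures.
From mathcomp Require Import all_boot all_order all_algebra.
From mathcomp Require Import all_classical all_reals all_analysis.
From mathcomp Require Import measurable_realfun ring lra zify.
Import Order.TTheory GRing.Theory Num.Theory.
Import numFieldNormedType.Exports.
Set Implicit Arguments.
Unset Strict Implicit.
Unset Printing Implicit Defensive.
Local Open Scope classical_set_scope.
Local Open Scope ring_scope.

(** Write n = 2l.  Each factor p^a - q^a equals p^a (1 - r^a), so the
    (p,q)-binomial is p^(k(n-k)) times the Gaussian binomial in r
    ([pqbinom_gbinom]).  With j = k - l one has k(n-k) = l^2 - j^2, hence
    p^(k(n-k)) = exp(-un/4) exp(u j^2/n): the p-part is a growing Gaussian
    exp((A/2) j^2/n + gamma (j/n^(3/4))^2).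

    The ratio of the k-th to the central Gaussian binomial is a product of
    factors 1 - r^a, and its logarithm is a sum of values of
    phi(t) = ln(1 - exp(-zt)) at points symmetric about t = 1/2 up to 1/n.
    Since A = 2 phi'(1/2), the growing Gaussian cancels the quadratic part of
    this logarithm.  What is left is minus the sum of the odd defects
    F(h) = phi(1/2+h) - phi(1/2-h) - A h at h = i/n, up to o(1).  As
    phi''(1/2) does not enter an odd function, F(h) ~ (B/3) h^3, and summing
    cubes gives -(B/12) j^4/n^3: this is why the fluctuations live at the
    scale n^(3/4) and have a quartic limiting density.  The derivative F' has
    a closed form ([is_derive_odd_defect]), from which both the asymptotics of
    F and the global bound F(h) >= b h^3 are read off ([odd_defect_asymp],
    [odd_defect_ge]).  They give the pointwise limit and the domination of the
    tilted ratios ([cvg_tilted_ratio], [tilted_ratio_le]), and dominated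
    convergence applied to step functions turns the sums over k into the
    integrals mu_m ([cvg_riemann_dominated], [cvg_moments]).  This proves the
    first asymptotics and the convergence of the moments.

    It remains to find the size of the central Gaussian binomial.  Weighting
    the Gaussian binomials by r^(j^2/2) instead makes their sum an explicit
    product, by the finite Jacobi triple product ([gbinom_theta]).  The same
    tilted ratios, now at the scale n^(1/2), show that this sum is the central
    term times sqrt n times a Gaussian integral, which produces d(z)
    ([cvg_central_gbinom]).  The product has the logarithm
    2 sum_i ln(1 + exp(-s_i)) at the midpoints s_i of a subdivision of
    [0, z/2], free of any singularity.  The function
    Li2(exp(-2s))/2 - Li2(exp(-s)) is a primitive of ln(1 + exp(-s)), so the
    midpoint rule evaluates the sum as n H(z) + o(1) ([cvg_theta_product]).
    The value of this primitive at 0 is -Li2(1)/2 = -pi^2/12; Li2(1) = pi^2/6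
    is obtained from the duplication formula for 1/sin^2 ([Li2_1]). *)

(** * Gaussian binomial coefficients *)

Section GaussianBinomial.
Variables (F : fieldType).
Implicit Types (p r s x : F) (n k l j : nat).

Definition qfact r n : F := \prod_(1 <= j < n.+1) (1 - r ^+ j).

Definition gbinom r n k : F := qfact r n / (qfact r k * qfact r (n - k)).

Lemma qfactS r n : qfact r n.+1 = qfact r n * (1 - r ^+ n.+1).
Proof. by rewrite /qfact big_nat_recr. Qed.

Lemma qfact0 r : qfact r 0 = 1.
Proof. by rewrite /qfact big_nil. Qed.

Lemma gbinom_sym r n k : (k <= n)%N -> gbinom r n (n - k) = gbinom r n k.
Proof. by move=> kn; rewrite /gbinom subKn// [qfact r k * _]mulrC. Qed.

Section NotRootOfUnity.
Variable r : F.
Hypothesis r_nroot : forall j, (0 < j)%N -> r ^+ j != 1.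

Lemma qfact_neq0 n : qfact r n != 0.
Proof.
elim: n => [|n IHn]; first by rewrite qfact0 oner_neq0.
by rewrite qfactS mulf_neq0// subr_eq0 eq_sym r_nroot.
Qed.

Lemma gbinomn0 n : gbinom r n 0 = 1.
Proof. by rewrite /gbinom qfact0 subn0 mul1r divff// qfact_neq0. Qed.

Lemma gbinomnn n : gbinom r n n = 1.
Proof. by rewrite -(gbinom_sym _ (leqnn n)) subnn gbinomn0. Qed.

Lemma gbinomS n k : (k < n)%N ->
  gbinom r n.+1 k.+1 = gbinom r n k.+1 + r ^+ (n - k) * gbinom r n k.
Proof.
move=> kn; rewrite /gbinom subSS.
have -> : (n - k = (n - k.+1).+1)%N by rewrite subnSK.
set m := (n - k.+1)%N; have -> : n = (k.+1 + m)%N by rewrite subnKC.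
rewrite !qfactS.
have := qfact_neq0 k; have := qfact_neq0 m; have := qfact_neq0 (k.+1 + m).
have := r_nroot (ltn0Sn k); have := r_nroot (ltn0Sn m).
rewrite eq_sym -subr_eq0 => h1; rewrite eq_sym -subr_eq0 => h2 h3 h4 h5.
have -> : r ^+ (k.+1 + m).+1 = r ^+ k.+1 * r ^+ m.+1 by rewrite -exprD addnS.
move: h1 h2 h3 h4 h5.
move: (qfact r (k.+1 + m)) (qfact r k) (qfact r m) (r ^+ k.+1) (r ^+ m.+1).
by move=> a b c d e h1 h2 h3 h4 h5; field; rewrite h1 h2 h4 h5.
Qed.

(** Induction on n: the Pascal rule [gbinomS] is exactly the identity between the
    coefficients of x^(k+1) after multiplication by 1 + x r^n. *)
Lemma qbinomial_theorem n x :
  \prod_(0 <= j < n) (1 + x * r ^+ j) =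
  \sum_(0 <= k < n.+1) gbinom r n k * r ^+ 'C(k, 2) * x ^+ k.
Proof.
elim: n => [|n IHn].
  by rewrite big_nil big_nat1 gbinomn0 bin0n !mulr1.
rewrite big_nat_recr// IHn/= mulrDr mulr1.
rewrite {1}big_nat_recl// mulr_suml [X in _ + X]big_nat_recr//.
rewrite [RHS]big_nat_recl// [in RHS]big_nat_recr//= !gbinomnn !gbinomn0 -addrA.
congr (_ + _); rewrite addrA; congr (_ + _); last first.
  by rewrite binS bin1 exprD exprS !mul1r; ring.
rewrite -big_split/= !big_nat; apply: eq_bigr => i /andP[_ iltn].
rewrite gbinomS// binS bin1 [r ^+ ('C(i, 2) + i)]exprD [x ^+ i.+1]exprS.
have -> : r ^+ n = r ^+ (n - i) * r ^+ i by rewrite -exprD subnK// ltnW.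
ring.
Qed.

End NotRootOfUnity.

Lemma qfactD r m k :
  qfact r (m + k) = qfact r m * \prod_(1 <= j < k.+1) (1 - r ^+ (m + j)).
Proof.
elim: k => [|k IHk]; first by rewrite big_nil mulr1 addn0.
by rewrite big_nat_recr//= mulrA -IHk addnS qfactS.
Qed.

(** Every numerator contributes p^(n-k) more than its denominator, whence the
    exponent k(n-k). *)
Lemma pqbinom_gbinom p r n k : (k <= n)%N -> p != 0 ->
  (forall j, (0 < j)%N -> r ^+ j != 1) ->
  \prod_(1 <= j < k.+1) ((p ^+ (n - k + j) - (p * r) ^+ (n - k + j)) /
       (p ^+ j - (p * r) ^+ j)) =
  p ^+ (k * (n - k)) * gbinom r n k.
Proof.
move=> kn p0 rn; rewrite /gbinom.
have -> : qfact r n = qfact r (n - k) * \prod_(1 <= j < k.+1) (1 - r ^+ (n - k + j)).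
  by rewrite -qfactD subnK.
have q0 := qfact_neq0 rn.
rewrite [qfact r k * _]mulrC -mulf_div divff// mul1r.
rewrite [in RHS]/qfact -prodf_div mulnC.
have -> : p ^+ ((n - k) * k) = \prod_(1 <= j < k.+1) p ^+ (n - k).
  by rewrite prodr_const_nat subn1 -exprM.
rewrite -big_split/= !big_nat; apply: eq_bigr => j /andP[j0 _].
have : 1 - r ^+ j != 0 by rewrite subr_eq0 eq_sym rn.
have : p ^+ j != 0 by rewrite expf_neq0.
rewrite !exprMn exprD; move: (p ^+ j) (r ^+ j) => a b a0 b0.
by field; rewrite b0 /= -{1}[a]mulr1 -mulrBr mulf_neq0.
Qed.

Lemma mul2_bin2 k : (2 * 'C(k, 2) + k = k ^ 2)%N.
Proof. by elim: k => // k; rewrite binS bin1; nia. Qed.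

(** Finite form of the Jacobi triple product with s = r^(1/2).  In the q-binomial
    theorem take n = 2l and x = s^(1-2l): the exponents of s become
    (k-l)^2 - l^2, and the factors with indices l-1-j and l+j combine into
    s^(-2j-1) (1 + s^(2j+1))^2. *)
Lemma gbinom_theta s l : s != 0 -> (forall j, (0 < j)%N -> s ^+ j != 1) ->
  \sum_(0 <= k < l.*2.+1) gbinom (s ^+ 2) l.*2 k * s ^+ (`|k%:Z - l%:Z|%N ^ 2) =
  \prod_(1 <= i < l.+1) (1 + s ^+ i.*2.-1) ^+ 2.
Proof.
move=> s0 sn; case: l => [|l].
  rewrite double0 big_nat1 big_nil gbinomn0 ?subrr ?mul1r//.
  by move=> j j0; rewrite -exprM sn// muln_gt0.
have rn j : (0 < j)%N -> (s ^+ 2) ^+ j != 1.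
  by move=> j0; rewrite -exprM sn// muln_gt0.
(* x = s^(1-2l), where l is l.+1 here *)
have := qbinomial_theorem rn l.+1.*2 (s ^- l.*2.+1).
move=> /(congr1 ( *%R (s ^+ (l.+1 ^ 2)))).
rewrite mulr_sumr => H; transitivity (s ^+ (l.+1 ^ 2) *
       \prod_(0 <= j < l.+1.*2) (1 + s ^- l.*2.+1 * s ^+ 2 ^+ j)).
  rewrite H !big_nat; apply: eq_bigr => k /andP[_ kl].
  rewrite mulrCA -[in RHS]mulrA; congr (_ * _).
  rewrite exprVn; apply: (@mulIf _ (s ^+ l.*2.+1 ^+ k)).
    by rewrite !expf_neq0.
  rewrite -[RHS]mulrA divfK ?expf_neq0//.
  rewrite -!exprM -!exprD; congr (_ ^+ _).
  have := mul2_bin2 k; set c := 'C(k, 2) => ck.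
  set m := `|_|%N; have : (m ^ 2 + 2 * (k * l.+1) = k ^ 2 + l.+1 ^ 2)%N.
    have [kl'|kl'] := leqP k l.+1.
      have -> : m = (l.+1 - k)%N by rewrite /m; lia.
      by have := subnKC kl'; move: (l.+1 - k)%N => d <-; nia.
    have -> : m = (k - l.+1)%N by rewrite /m; lia.
    by have := subnKC (ltnW kl'); move: (k - l.+1)%N => d <-; nia.
  by nia.
pose f j := 1 + s ^- l.*2.+1 * s ^+ 2 ^+ j.
rewrite -[X in _ * X]/(\prod_(0 <= j < l.+1.*2) f j).
have -> : \prod_(0 <= j < l.+1.*2) f j =
          \prod_(0 <= j < l.+1) (f (l - j)%N * f (j + l.+1)%N).
  rewrite -addnn (big_cat_nat (n := l.+1)) ?leq_addr//= big_split/=.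
  congr (_ * _); first by rewrite big_nat_rev/= add0n.
  by rewrite -{1}[l.+1]add0n big_addn addnK.
have -> : s ^+ (l.+1 ^ 2) = \prod_(0 <= j < l.+1) s ^+ j.*2.+1.
  elim: l.+1 => [|m IHm]; first by rewrite big_nil.
  by rewrite big_nat_recr//= -IHm -exprD; congr (_ ^+ _); nia.
rewrite -big_split/= [RHS]big_add1/= !big_nat; apply: eq_bigr => j /andP[_ jl].
have -> : f (l - j)%N = 1 + s ^- j.*2.+1.
  rewrite /f -exprM (_ : l.*2.+1 = (j.*2.+1 + 2 * (l - j))%N); last by lia.
  by rewrite exprD invfM -mulrA mulVf ?mulr1 ?expf_neq0.
have -> : f (j + l.+1)%N = 1 + s ^+ j.*2.+1.
  rewrite /f -exprM (_ : (2 * _ = l.*2.+1 + j.*2.+1)%N); last by lia.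
  by rewrite exprD mulKf ?expf_neq0.
by rewrite mulrA [_ * (1 + s ^- _)]mulrDr mulr1 divff ?expf_neq0// addrC -expr2.
Qed.
End GaussianBinomial.

(** * Mean value comparison and sine bounds *)

Section Calculus.
Variable R : realType.
Implicit Types (a b x : R) (f g : R -> R).

Lemma cvgrX (T : Type) (F : set_system T) (FF : Filter F) (f : T -> R) (l : R) n :
  f @ F --> l -> f t ^+ n @[t --> F] --> l ^+ n.
Proof.
move=> fl; apply: (cvg_comp f (fun x => x ^+ n) fl); exact: exprn_continuous.
Qed.

Lemma cvg_expR_comp (T : Type) (F : set_system T) (FF : Filter F) (f : T -> R) (l : R) :
  f @ F --> l -> expR (f t) @[t --> F] --> expR l.
Proof. move=> fl; apply: (cvg_comp f expR fl); exact: continuous_expR. Qed.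

(** The mean value theorem for g - f, with derivatives on the open interval so
    that it reaches endpoints where a function is merely continuous.  The
    Taylor-type estimates below come from it by comparison with explicit
    polynomials. *)
Lemma deriv_le f g df dg a b : a <= b ->
  (forall x, a < x < b -> is_derive x 1 f (df x)) ->
  (forall x, a < x < b -> is_derive x 1 g (dg x)) ->
  {within `[a, b], continuous f} -> {within `[a, b], continuous g} ->
  (forall x, a < x < b -> df x <= dg x) ->
  f b - f a <= g b - g a.
Proof.
rewrite le_eqVlt => /predU1P[->|ab] fd gd cf cg dfg; first by rewrite !subrr.
have [c cab] : exists2 c, c \in `]a, b[%R &
    (g - f) b - (g - f) a = (dg c - df c) * (b - a).
  apply: (@MVT _ (g - f) (fun x => dg x - df x)) => //.
    by move=> x; rewrite in_itv/= => xab; apply: is_deriveB; [exact: gd|exact: fd].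
  by move=> x; apply: cvgB; [exact: cg|exact: cf].
move: cab; rewrite in_itv/= => cab E.
have : 0 <= (dg c - df c) * (b - a).
  by rewrite mulr_ge0// subr_ge0 ?dfg// ltW.
by rewrite -E !fctE; lra.
Qed.

Lemma sin_le x : 0 <= x -> sin x <= x.
Proof.
move=> x0; have := @deriv_le sin id cos (fun=> 1) 0 x x0.
rewrite sin0 !subr0; apply.
- exact/continuous_subspaceT/continuous_sin.
- by apply: continuous_subspaceT => y; exact: cvg_id.
- by move=> y _; exact: cos_le1.
Qed.

Lemma mul_cos_le_sin x : 0 <= x <= pi / 2 -> x * cos x <= sin x.
Proof.
move=> /andP[x0 xpi].
have := @deriv_le (fun y => y * cos y) sin (fun y => cos y - y * sin y) cos 0 x x0.
rewrite sin0 mul0r !subr0; apply.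
- move=> y _; apply: is_derive_eq; rewrite /GRing.scale/= mulrN mulr1; lra.
- apply: continuous_subspaceT => y; apply: cvgM; first exact: cvg_id.
  exact: continuous_cos.
- exact/continuous_subspaceT/continuous_sin.
- move=> y /andP[y0 yx]; rewrite lerBlDr lerDl mulr_ge0 ?(ltW y0)//.
  have := pi_gt0 R => pi0.
  by rewrite sin_ge0_pi// (ltW y0)/=; lra.
Qed.

(** Consequence of sin x <= x <= tan x and 1/sin^2 = 1 + cot^2. *)
Lemma sinV2_bounds x : 0 < x < pi / 2 ->
  x ^- 2 <= sin x ^- 2 <= x ^- 2 + 1.
Proof.
move=> /andP[x0 xpi].
have pi0 := pi_gt0 R.
have s0 : 0 < sin x by rewrite sin_gt0_pihalf// x0.
have sx := sin_le (ltW x0).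
have cs : x * cos x <= sin x by rewrite mul_cos_le_sin// !ltW.
have c0 : 0 <= cos x by rewrite cos_ge0_pihalf// (ltW xpi) andbT; lra.
apply/andP; split.
  by rewrite lef_pV2 ?posrE ?exprn_gt0// lerXn2r ?nnegrE//; apply: ltW.
rewrite -lerBlDr -[1](@divff _ (sin x ^+ 2)) ?expf_neq0 ?gt_eqF//.
rewrite -[X in X - _]mul1r -mulrBl -cos2sin2.
rewrite ler_pdivrMr ?exprn_gt0// mulrC ler_pdivlMr ?exprn_gt0//.
by rewrite -exprMn mulrC lerXn2r ?nnegrE// ?mulr_ge0// ltW.
Qed.

(** From sin x = 2 sin(x/2) cos(x/2), since 1/(sc)^2 = 1/s^2 + 1/c^2 when
    s^2 + c^2 = 1. *)
Lemma sinV2_half x : 0 < x < pi / 2 ->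
  sin x ^- 2 = (sin (x / 2) ^- 2 + sin (pi / 2 - x / 2) ^- 2) / 4.
Proof.
move=> /andP[x0 xpi].
have s0 : 0 < sin (x / 2) by rewrite sin_gt0_pihalf//; lra.
have c0 : 0 < cos (x / 2) by rewrite cos_gt0_pihalf//; lra.
have -> : sin (pi / 2 - x / 2) = cos (x / 2) by rewrite addrC sinDpihalf cosN.
rewrite {1}(_ : x = (x / 2) *+ 2); last by rewrite -mulr_natr; field.
rewrite sin_mulr2n.
have := cos2Dsin2 (x / 2).
move: (sin (x / 2)) (cos (x / 2)) s0 c0 => s c s0 c0 E.
rewrite [LHS](_ : _ = (c ^+ 2 + s ^+ 2) / ((c * s) *+ 2) ^+ 2).
  by rewrite -mulr_natr; field; rewrite !gt_eqF.
by rewrite E mul1r.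
Qed.

(** Applying [sinV2_half] to each term sends the grid of odd multiples of
    pi/(4 2^m) to the grid of odd multiples of pi/(4 2^(m+1)): the halves fill the
    lower part of the new grid, and their complements to pi/2 the upper part. *)
Lemma sum_sinV2 m :
  \sum_(0 <= k < 2 ^ m) sin ((2 * k + 1)%:R * pi / (4 * 2 ^+ m)) ^- 2 =
  2 * 4 ^+ m :> R.
Proof.
have pi0 := pi_gt0 R.
elim: m => [|m IHm].
  rewrite expn0 big_nat1 expr0 muln0 add0n mul1r !mulr1.
  have : cos (pi / 4) = sin (pi / 4) :> R.
    by rewrite -cosN -sinDpihalf; congr sin; field.
  have := cos2Dsin2 (pi / 4 : R) => /[swap] ->.
  by move=> h; rewrite (_ : _ ^+ 2 = 2^-1) ?invrK//; lra.
rewrite [4 ^+ _]exprS mulrCA -IHm mulr_sumr expnS mul2n -addnn.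
rewrite (big_cat_nat (n := 2 ^ m)) ?leq_addr//=.
rewrite -{2}[(2 ^ m)%N]add0n big_addn addnK [X in _ + X]big_nat_rev/= -big_split/=.
rewrite !big_nat; apply: eq_bigr => k /andP[_ km]; rewrite add0n.
have p2 : 0 < 2 ^+ m :> R by rewrite exprn_gt0.
rewrite [in RHS]sinV2_half; last first.
  apply/andP; split; first by rewrite divr_gt0 ?mulr_gt0// ltr0n addn1.
  rewrite ltr_pdivrMr ?mulr_gt0//.
  have : (2 * k + 1)%:R < 2 * 2 ^+ m :> R.
    by rewrite -natrX -natrM ltr_nat; lia.
  by nra.
rewrite [RHS]mulrC divfK//; congr (sin _ ^- 2 + sin _ ^- 2).
  by rewrite exprS; field; rewrite gt_eqF.
rewrite exprS (_ : _%:R = 4 * 2 ^+ m - (2 * k + 1)%:R).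
  by field; rewrite gt_eqF.
rewrite -natrX -natrM -natrB; last lia.
congr _%:R; lia.
Qed.
End Calculus.

(** * The Basel problem *)

Section Basel.
Variable R : realType.

Let zeta2 (n : nat) : R := \sum_(1 <= k < n.+1) k%:R ^- 2.
Let odd2 (n : nat) : R := \sum_(0 <= k < n) (2 * k + 1)%:R ^- 2.

(** In [sum_sinV2] each 1/sin^2 y is 1/y^2 up to an error in [0, 1], and the sum
    of the 1/y^2 is 16 4^m / pi^2 times the sum of the inverse odd squares.  The
    total error 2^m is negligible against 4^m. *)
Lemma sum_odd_sqrV_bounds m :
  pi ^+ 2 / 8 - pi ^+ 2 / (16 * 2 ^+ m) <= odd2 (2 ^ m) <= pi ^+ 2 / 8.
Proof.
have pi0 := pi_gt0 R.
have p2 : 0 < 2 ^+ m :> R by rewrite exprn_gt0.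
pose y k : R := (2 * k + 1)%:R * pi / (4 * 2 ^+ m).
have yb k : (k < 2 ^ m)%N -> y k ^- 2 <= sin (y k) ^- 2 <= y k ^- 2 + 1.
  move=> km; apply: sinV2_bounds; apply/andP; split.
    by rewrite divr_gt0 ?mulr_gt0// ltr0n addn1.
  rewrite ltr_pdivrMr ?mulr_gt0//.
  have : (2 * k + 1)%:R < 2 * 2 ^+ m :> R.
    by rewrite -natrX -natrM ltr_nat; lia.
  by nra.
have fE : 4 ^+ m = 2 ^+ m * 2 ^+ m :> R by rewrite -exprMn -natrM.
have yE : \sum_(0 <= k < 2 ^ m) y k ^- 2 = 16 * 4 ^+ m / pi ^+ 2 * odd2 (2 ^ m).
  rewrite mulr_sumr; apply: eq_bigr => k _; rewrite /y fE.
  have : 0 < (2 * k + 1)%:R :> R by rewrite ltr0n addn1.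
  move: (2 * k + 1)%:R (2 ^+ m) p2 (@pi R) pi0 => a c c0 P P0 a0.
  by field; rewrite !gt_eqF.
have c0 : 0 < 4 ^+ m :> R by rewrite exprn_gt0.
have lo : \sum_(0 <= k < 2 ^ m) y k ^- 2 <= 2 * 4 ^+ m.
  by rewrite -sum_sinV2 !big_nat; apply: ler_sum => k /andP[_ /yb/andP[]].
have hi : 2 * 4 ^+ m <= \sum_(0 <= k < 2 ^ m) y k ^- 2 + 2 ^+ m.
  have -> : 2 ^+ m = \sum_(0 <= k < 2 ^ m) (1 : R).
    by rewrite sumr_const_nat subn0 natrX.
  by rewrite -sum_sinV2 -big_split/= !big_nat; apply: ler_sum => k /andP[_ /yb/andP[]].
move: lo hi; rewrite yE fE.
move: (odd2 _) (2 ^+ m) p2 (@pi R) pi0 => S c cp P P0 lo hi.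
have pp : 0 < P ^+ 2 :> R by rewrite exprn_gt0.
apply/andP; split.
  rewrite -lerBlDr in hi.
  have : P ^+ 2 / (16 * c * c) * (2 * (c * c) - c) <=
         P ^+ 2 / (16 * c * c) * (16 * (c * c) / P ^+ 2 * S).
    by rewrite ler_pM2l// divr_gt0 ?mulr_gt0.
  have -> : P ^+ 2 / (16 * c * c) * (16 * (c * c) / P ^+ 2 * S) = S.
    by field; rewrite !gt_eqF.
  by apply: le_trans; rewrite le_eqVlt; apply/orP; left; apply/eqP; field; rewrite gt_eqF.
have : P ^+ 2 / (16 * c * c) * (16 * (c * c) / P ^+ 2 * S) <=
         P ^+ 2 / (16 * c * c) * (2 * (c * c)).
  by rewrite ler_pM2l// divr_gt0 ?mulr_gt0.
have -> : P ^+ 2 / (16 * c * c) * (16 * (c * c) / P ^+ 2 * S) = S.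
  by field; rewrite !gt_eqF.
by move=> /le_trans; apply; rewrite le_eqVlt; apply/orP; left; apply/eqP; field; rewrite gt_eqF.
Qed.

Let zeta2S n : zeta2 n.+1 = zeta2 n + n.+1%:R ^- 2.
Proof. by rewrite /zeta2 big_nat_recr. Qed.

Lemma zeta2_double n : zeta2 n.*2 = odd2 n + zeta2 n / 4.
Proof.
elim: n => [|n IHn]; first by rewrite /zeta2 /odd2 !big_nil mul0r addr0.
rewrite doubleS !zeta2S IHn [odd2 n.+1]/odd2 big_nat_recr//= -/(odd2 n).
rewrite -addrA -!addrA; congr (_ + _); rewrite addrCA; congr (_ + _).
  by congr (_%:R ^- 2); lia.
rewrite mulrDl; congr (_ + _).
have -> : n.*2.+2%:R = 2 * n.+1%:R :> R by rewrite -natrM; congr _%:R; lia.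
by field; rewrite nat1r pnatr_eq0.
Qed.

Lemma zeta2_nd : nondecreasing_seq zeta2.
Proof.
apply/nondecreasing_seqP => n; rewrite zeta2S lerDl.
by rewrite invr_ge0 exprn_ge0.
Qed.

Lemma odd2_nd : nondecreasing_seq odd2.
Proof.
apply/nondecreasing_seqP => n; rewrite /odd2 [leRHS]big_nat_recr//= lerDl.
by rewrite invr_ge0 exprn_ge0.
Qed.

Lemma zeta2_ub n : zeta2 n <= pi ^+ 2 / 6.
Proof.
have h : odd2 n <= pi ^+ 2 / 8.
  have /andP[_] := sum_odd_sqrV_bounds n; apply: le_trans.
  by apply: odd2_nd; rewrite ltnW// ltn_expl.
have : zeta2 n <= zeta2 n.*2 by apply: zeta2_nd; rewrite -addnn leq_addr.
by rewrite zeta2_double; lra.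
Qed.

(** The limit Z satisfies Z = pi^2/8 + Z/4, by separating odd and even
    denominators along the indices 2^m. *)
Theorem cvg_zeta2 : zeta2 @ \oo --> pi ^+ 2 / 6.
Proof.
have cz : cvgn zeta2.
  apply: nondecreasing_is_cvgn; first exact: zeta2_nd.
  by exists (pi ^+ 2 / 6) => _ [n _ <-]; exact: zeta2_ub.
suff <- : limn zeta2 = pi ^+ 2 / 6 by [].
(* the sine identity gives information only along powers of two *)
have sub2 : ((fun m => 2 ^ m)%N @ \oo --> \oo).
  apply/cvgnyPge => A; exists A => // n /= An.
  by rewrite (leq_trans An)// ltnW// ltn_expl.
have c1 : zeta2 (2 ^ m)%N @[m --> \oo] --> limn zeta2.
  exact: (cvg_comp _ _ sub2 cz).
have c2 : zeta2 (2 ^ m).*2%N @[m --> \oo] --> limn zeta2.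
  move: c1; rewrite -cvg_shiftS/=.
  by under eq_fun do rewrite expnS mul2n.
have co : odd2 (2 ^ m)%N @[m --> \oo] --> (pi ^+ 2 / 8 : R).
  apply: (@squeeze_cvgr _ _ _ _ (fun m => pi ^+ 2 / 8 - pi ^+ 2 / 16 * 2^-1 ^+ m)
           (fun=> pi ^+ 2 / 8)).
  - near=> m; have := sum_odd_sqrV_bounds m.
    by rewrite invfM mulrA exprVn.
  - rewrite -[X in _ --> X]subr0 -[X in _ - X](mulr0 (pi ^+ 2 / 16)).
    apply: cvgB; first exact: cvg_cst.
    apply: cvgM; first exact: cvg_cst.
    by apply: cvg_expr; rewrite ger0_norm ?invf_lt1 ?ltr1n.
  - exact: cvg_cst.
have : zeta2 (2 ^ m).*2%N @[m --> \oo] --> pi ^+ 2 / 8 + limn zeta2 / 4.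
  under eq_fun do rewrite zeta2_double.
  by apply: cvgD => //; apply: cvgM => //; exact: cvg_cst.
move=> c3; have /(_ _) /= := cvg_unique (@Rhausdorff R) c2 c3.
by move: (limn zeta2 : R) => L E; lra.
Unshelve. all: by end_near. Qed.

Lemma Li2_1 : Li2 1 = pi ^+ 2 / 6 :> R.
Proof.
rewrite /Li2; under eq_fun do under eq_bigr do rewrite expr1n mul1r.
exact/cvg_lim/cvg_zeta2.
Qed.
End Basel.

(** * The dilogarithm and the product of 1 + exp(-s_i) *)

Section Dilogarithm.
Variable R : realType.
Implicit Types (x s m h K : R) (c : R^nat).

(** With t = sqrt K, the inequality (k+1) t^k <= 1/(1-t) bounds the terms by
    t^k/(1-t). *)
Lemma is_cvg_pseries_linear c K : 0 <= K < 1 ->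
  (forall k, 0 <= c k <= k.+1%:R) -> cvgn (pseries c K).
Proof.
move=> /andP[K0 K1] ck.
pose t : R := Num.sqrt K.
have t0 : 0 <= t by exact: sqrtr_ge0.
have t1 : t < 1 by rewrite -[ltRHS]sqrtr1 ltr_sqrt.
have tK k : K ^+ k = t ^+ k * t ^+ k by rewrite -exprMn -expr2 sqr_sqrtr.
have b k : k.+1%:R * t ^+ k <= (1 - t)^-1.
  have : \sum_(0 <= i < k.+1) t ^+ k <= series (geometric 1 t) k.+1.
    rewrite /series/= !big_nat; apply: ler_sum => i /andP[_ ik].
    by rewrite mul1r ler_wiXn2l// ltW.
  rewrite sumr_const_nat subn0 => Hb; rewrite mulr_natl; apply: (le_trans Hb).
  rewrite geometric_seriesE ?lt_eqF//= mul1r -[leRHS]mul1r.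
  by rewrite ler_pM2r ?invr_gt0 ?subr_gt0// lerBlDr lerDl exprn_ge0.
apply: (@series_le_cvg _ _ (geometric (1 - t)^-1 t)).
- by move=> k; rewrite mulr_ge0 ?exprn_ge0//; case/andP: (ck k).
- by move=> k; rewrite /= mulr_ge0 ?exprn_ge0// invr_ge0 subr_ge0 ltW.
- move=> k; rewrite /= tK mulrA ler_wpM2r ?exprn_ge0//.
  by rewrite (le_trans _ (b k))// ler_wpM2r ?exprn_ge0//; case/andP: (ck k).
- by apply: is_cvg_geometric_series; rewrite ger0_norm.
Qed.

Let lnc : R^nat := fun k => k%:R^-1.
Let li2c : R^nat := fun k => k%:R ^- 2.

Let lnc0 : lnc 0%N = 0.
Proof. by rewrite /lnc invr0. Qed.

Let li2c0 : li2c 0%N = 0.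
Proof. by rewrite /li2c expr0n invr0. Qed.

Let diffs_lnc : pseries_diffs lnc = fun=> 1.
Proof. by apply/funext => k; rewrite /pseries_diffs divff. Qed.

Let diffs2_lnc : pseries_diffs (pseries_diffs lnc) = fun k => k.+1%:R.
Proof. by rewrite diffs_lnc; apply/funext => k; rewrite /pseries_diffs mulr1. Qed.

Let diffs_li2c : pseries_diffs li2c = fun k => k.+1%:R^-1.
Proof.
apply/funext => k; rewrite /pseries_diffs /li2c expr2 invfM mulrA divff//.
by rewrite mul1r.
Qed.

Let lnc_bd k : 0 <= lnc k <= k.+1%:R.
Proof.
rewrite /lnc invr_ge0 ler0n/=; case: k => [|k]; first by rewrite invr0 ler0n.
by rewrite (@le_trans _ _ 1)// ?invf_le1// ler1n.
Qed.

Let li2c_bd k : 0 <= li2c k <= k.+1%:R.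
Proof.
rewrite /li2c invr_ge0 exprn_ge0//=; case: k => [|k].
  by rewrite expr0n invr0 ler0n.
by rewrite (@le_trans _ _ 1)// ?invf_le1 ?exprn_ege1 ?exprn_gt0// ler1n.
Qed.

(** Both sides vanish at 0 and have the derivative 1/(1-y). *)
Lemma ln_pseries x : 0 <= x < 1 -> limn (pseries lnc x) = - ln (1 - x).
Proof.
move=> /andP[x0 x1].
pose F (y : R) : R := limn (pseries lnc y).
pose K := (1 + x) / 2.
have K01 : 0 <= K < 1 by rewrite /K; apply/andP; split; lra.
have dF (y : R) : 0 <= y <= x -> is_derive y 1 F (1 - y)^-1.
  move=> /andP[y0 yx].
  have -> : (1 - y)^-1 = limn (pseries (pseries_diffs lnc) y).
    rewrite diffs_lnc; apply/esym/cvg_lim => //.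
    rewrite -[X in _ --> X]mul1r; apply: cvg_geometric_series.
    by rewrite ger0_norm//; lra.
  apply: (@pseries_snd_diffs _ _ K).
  - by apply: is_cvg_pseries_linear.
  - by apply: is_cvg_pseries_linear => // k; rewrite diffs_lnc ler01 ler1n.
  - by apply: is_cvg_pseries_linear => // k; rewrite diffs2_lnc lexx ler0n.
  - by rewrite !ger0_norm /K; lra.
have dL (y : R) : 0 <= y <= x -> is_derive y 1 (fun t : R => - ln (1 - t)) (1 - y)^-1.
  move=> /andP[y0 yx].
  have y1 : 0 < 1 - y by lra.
  have := is_derive1_ln y1 => h.
  have : is_derive y 1 (@ln R \o (fun t : R => 1 - t)) ((1 - y)^-1 * (0 - 1)).
    by apply: is_derive1_comp.
  by move=> h2; apply: is_derive_eq; rewrite sub0r mulrN1 opprK.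
have cF (f : R -> R) : (forall y, 0 <= y <= x -> is_derive y 1 f (1 - y)^-1) ->
    {within `[0, x], continuous f}.
  move=> df; apply: derivable_within_continuous => y.
  by rewrite in_itv/= => /df[].
have F0 : F 0 = 0.
  rewrite /F (_ : pseries _ _ = fun=> 0) ?lim_cst//.
  apply/funext => N; rewrite /pseries /series/= big1// => -[|k] _.
    by rewrite /lnc invr0 mul0r.
  by rewrite expr0n mulr0.
have inc (y : R) : 0 < y < x -> 0 <= y <= x by move=> /andP[? ?]; rewrite !ltW.
have h1 : F x - F 0 <= - ln (1 - x) - (- ln (1 - 0)).
  by apply: (@deriv_le _ F (fun t : R => - ln (1 - t)) (fun y => (1 - y)^-1)
     (fun y => (1 - y)^-1)) => // [y /inc/dF|y /inc/dL||]//; exact: cF.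
have h2 : - ln (1 - x) - (- ln (1 - 0)) <= F x - F 0.
  by apply: (@deriv_le _ (fun t : R => - ln (1 - t)) F (fun y => (1 - y)^-1)
     (fun y => (1 - y)^-1)) => // [y /inc/dL|y /inc/dF||]//; exact: cF.
move: h1 h2; rewrite F0 !subr0 ln1 oppr0 subr0 => h1 h2.
by apply/eqP; rewrite eq_le h1 h2.
Qed.

Let li2 x : R := limn (pseries li2c x).

Let pseries_li2c x N :
  pseries li2c x N.+1 = \sum_(1 <= k < N.+1) (x ^+ k / k%:R ^+ 2).
Proof.
rewrite /pseries /series/= big_nat_recl// /li2c expr0n invr0 mul0r add0r.
by rewrite big_add1/=; apply: eq_bigr => k _; rewrite mulrC.
Qed.

Lemma is_cvg_li2 x : 0 <= x <= 1 -> cvgn (pseries li2c x).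
Proof.
move=> /andP[x0 x1].
apply: (@series_le_cvg _ _ li2c).
- by move=> k; rewrite mulr_ge0 ?exprn_ge0//; case/andP: (li2c_bd k).
- by move=> k; case/andP: (li2c_bd k).
- by move=> k; rewrite ler_piMr ?exprn_ile1//; case/andP: (li2c_bd k).
- apply/cvg_ex; exists (pi ^+ 2 / 6); rewrite -cvg_shiftS/=.
  apply: cvg_trans (@cvg_zeta2 R); apply: near_eq_cvg; near=> n.
  rewrite /series/= [RHS]big_nat_recl// li2c0 add0r.
  by rewrite big_add1.
Unshelve. all: by end_near. Qed.

Lemma li2E x : 0 <= x <= 1 -> li2 x = Li2 x.
Proof.
move=> x01; apply/esym/cvg_lim => //.
have : pseries li2c x @ \oo --> li2 x by exact: is_cvg_li2.
rewrite -cvg_shiftS.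
by under eq_fun do rewrite pseries_li2c.
Qed.

(** Termwise differentiation gives the series of x^k/(k+1), that is -ln(1-x)/x. *)
Lemma is_derive_li2 x : 0 < x < 1 -> is_derive x 1 li2 (- ln (1 - x) / x).
Proof.
move=> /andP[x0 x1]; pose K := (1 + x) / 2.
have K01 : 0 <= K < 1 by rewrite /K; apply/andP; split; lra.
have -> : - ln (1 - x) / x = limn (pseries (pseries_diffs li2c) x).
  rewrite diffs_li2c -ln_pseries; last by rewrite x1 ltW.
  apply/esym/cvg_lim => //.
  have c1 : pseries lnc x n.+1 @[n --> \oo] --> limn (pseries lnc x).
    by rewrite cvg_shiftS; apply: is_cvg_pseries_linear => //; rewrite ltW.
  have c2 : pseries lnc x n.+1 * x^-1 @[n --> \oo] --> limn (pseries lnc x) / x.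
    by apply: cvgM => //; exact: cvg_cst.
  apply: cvg_trans c2; apply: near_eq_cvg; near=> n => /=.
  rewrite /pseries /series/= [in LHS]big_nat_recl// lnc0 mul0r add0r mulr_suml.
  apply: eq_bigr => k _.
  by rewrite exprS -[LHS]mulrA [x * _]mulrC mulfK// gt_eqF.
apply: (@pseries_snd_diffs _ _ K).
- by apply: is_cvg_pseries_linear.
- apply: is_cvg_pseries_linear => // k; rewrite diffs_li2c invr_ge0 ler0n/=.
  by rewrite (@le_trans _ _ 1)// ?invf_le1// ler1n.
- apply: is_cvg_pseries_linear => // k; rewrite diffs_li2c /pseries_diffs.
  rewrite divr_ge0//= ler_pdivrMr// ler_peMr// ler1n//.
- by rewrite !ger0_norm /K; lra.
Unshelve. all: by end_near. Qed.


(** Abel continuity of the dilogarithm at 1.  The terms being nonnegative,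
    Li2(x) lies between its partial sum at x and Li2(1); the partial sum is
    continuous, and close to Li2(1) at x = 1. *)
Lemma cvg_li2_expRN (c : R) : 0 < c ->
  li2 (expR (- (c * s))) @[s --> 0^'+] --> li2 1.
Proof.
move=> c0.
have c1 : pseries li2c 1 @ \oo --> li2 1 by apply: is_cvg_li2; rewrite ler01 lexx.
have nd (x : R) : 0 <= x -> nondecreasing_seq (pseries li2c x).
  move=> x0; apply/nondecreasing_seqP => n.
  rewrite /pseries /series/= [leRHS]big_nat_recr//= lerDl.
  by rewrite mulr_ge0 ?exprn_ge0//; case/andP: (li2c_bd n).
have cp M : pseries li2c (expR (- (c * s))) M @[s --> 0] --> pseries li2c 1 M.
  elim: M => [|M IHM].
    rewrite /pseries/series/= big_nil.
    under eq_fun do rewrite big_nil.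
    exact: cvg_cst.
  have E x : pseries li2c x M.+1 = pseries li2c x M + li2c M * x ^+ M.
    by rewrite /pseries/series/= big_nat_recr.
  rewrite E; under eq_fun do rewrite E.
  apply: cvgD => //; apply: cvgM; first exact: cvg_cst.
  apply: cvgrX; rewrite -expR0; apply: cvg_expR_comp.
  rewrite -[X in _ --> X]oppr0 -[X in - X](mulr0 c); apply: cvgN.
  by apply: cvgM; [exact: cvg_cst|exact: cvg_id].
apply/cvgrPdist_le => e e0; near \oo => N.
have hN : `|li2 1 - pseries li2c 1 N| <= e / 2.
  by near: N; move/cvgrPdist_le: c1; apply; rewrite divr_gt0.
have cN : pseries li2c (expR (- (c * s))) N @[s --> 0^'+] --> pseries li2c 1 N.
  apply: cvg_at_right_filter; exact: cp.
near=> s.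
have s0 : 0 < s by [].
have e01 : 0 <= expR (- (c * s)) <= 1 by rewrite expR_ge0 expR_le1 oppr_le0 mulr_ge0// ltW.
have h1 : `|pseries li2c 1 N - pseries li2c (expR (- (c * s))) N| <= e / 2.
  by near: s; move/cvgrPdist_le: cN; apply; rewrite divr_gt0.
have h2 : pseries li2c (expR (- (c * s))) N <= li2 (expR (- (c * s))).
  apply: nondecreasing_cvgn_le; last exact: is_cvg_li2.
  by apply: nd; exact: expR_ge0.
have h3 : li2 (expR (- (c * s))) <= li2 1.
  apply: ler_lim; [exact: is_cvg_li2|by apply/cvg_ex; exists (li2 1)|].
  near=> n; rewrite /pseries /series/=; apply: ler_sum => k _.
  case/andP: (li2c_bd k) => k0 _; rewrite ler_wpM2l// expr1n.
  by rewrite exprn_ile1//; case/andP: e01.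
move: hN h1 h2 h3; rewrite !ler_norml => /andP[? ?] /andP[? ?] ? ?.
by apply/andP; split; lra.
Unshelve. all: by end_near. Qed.

Let softplus_prim s : R := li2 (expR (- (2 * s))) / 2 - li2 (expR (- (1 * s))).

Lemma is_derive_li2_expRN (c s : R) : 0 < c -> 0 < s ->
  is_derive s 1 (fun t => li2 (expR (- (c * t)))) (c * ln (1 - expR (- (c * s)))).
Proof.
move=> c0 s0; have cs0 : 0 < c * s by exact: mulr_gt0.
have e01 : 0 < expR (- (c * s)) < 1 by rewrite expR_gt0 expR_lt1 oppr_lt0.
have d1 := is_derive_li2 e01.
have d2 : is_derive s 1 (fun t => - (c * t)) (- c).
  by apply: is_derive_eq; rewrite /GRing.scale/=; ring.
have d3 : is_derive s 1 (expR \o (fun t => - (c * t))) (expR (- (c * s)) * - c).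
  exact: is_derive1_comp.
have d4 : is_derive s 1 (li2 \o (expR \o (fun t => - (c * t))))
    ((- ln (1 - expR (- (c * s))) / expR (- (c * s))) * (expR (- (c * s)) * - c)).
  exact: is_derive1_comp.
apply: is_derive_eq.
by rewrite mulrA divfK ?gt_eqF ?expR_gt0// mulrNN mulrC.
Qed.

(** The derivative is ln(1 - exp(-2s)) - ln(1 - exp(-s)). *)
Lemma is_derive_softplus_prim s : 0 < s ->
  is_derive s 1 softplus_prim (ln (1 + expR (- s))).
Proof.
move=> s0; have d1 := @is_derive_li2_expRN 1 s ltr01 s0.
have d2 := @is_derive_li2_expRN 2 s (ltr0Sn _ _) s0.
have e1 : expR (- s) < 1 by rewrite expR_lt1 oppr_lt0.
have -> : ln (1 + expR (- s)) =
   2^-1 *: (2 * ln (1 - expR (- (2 * s)))) - 1 * ln (1 - expR (- (1 * s))).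
  rewrite /GRing.scale/= mulKf// !mul1r.
  have -> : 1 - expR (- (2 * s)) = (1 - expR (- s)) * (1 + expR (- s)).
    by rewrite -mulrN expRM_natl; ring.
  by rewrite lnM ?posrE ?subr_gt0 ?addr_gt0 ?expR_gt0//; ring.
have -> : softplus_prim = (2^-1 *: (fun t => li2 (expR (- (2 * t))))) -
              (fun t => li2 (expR (- (1 * t)))).
  by apply/funext => t; rewrite /softplus_prim !fctE /GRing.scale/= mulrC.
by apply: is_deriveB; apply: is_deriveZ.
Qed.

Lemma continuous_softplus_prim a b : 0 <= a < b ->
  {within `[a, b], continuous softplus_prim}.
Proof.
move=> /andP[a0 ab].
have cL x : 0 < x -> {for x, continuous softplus_prim}.
  move=> x0; apply: differentiable_continuous; apply/derivable1_diffP.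
  by case: (is_derive_softplus_prim x0).
apply/continuous_within_itvP => //; split.
- by move=> x; rewrite in_itv/= => /andP[ax _]; apply: cL; apply: le_lt_trans ax.
- move: a0; rewrite le_eqVlt => /predU1P[<-|a0]; last first.
    by apply: cvg_at_right_filter; exact: cL.
  rewrite {2}/softplus_prim !mulr0 oppr0 expR0.
  apply: cvgB; last exact: cvg_li2_expRN.
  by apply: cvgM; [exact: cvg_li2_expRN|exact: cvg_cst].
- by apply: cvg_at_left_filter; apply: cL; apply: le_lt_trans ab.
Qed.

(** Tangent line at m from below and a parabola from above.  After subtracting
    ln(1 + exp(-m)) the function is ln(1 - p + p exp(-x)); the lower bound is
    convexity of the exponential, the upper one ln(1+y) <= y. *)
Lemma ln1DexpRN_bounds m x p : `|x| <= 2^-1 ->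
  p = expR (- m) / (1 + expR (- m)) ->
  ln (1 + expR (- m)) - p * x <= ln (1 + expR (- (m + x))) <=
  ln (1 + expR (- m)) - p * x + 2 * x ^+ 2.
Proof.
move=> xh pE; have e0 := expR_gt0 (- m).
have p0 : 0 <= p by rewrite pE divr_ge0// ltW// addr_gt0.
have p1 : p <= 1 by rewrite pE ler_pdivrMr ?addr_gt0// mul1r lerDr.
have E : 1 + expR (- (m + x)) = (1 + expR (- m)) * (1 - p + p * expR (- x)).
  by rewrite opprD expRD pE; field; rewrite gt_eqF// addr_gt0.
have c0 : 0 < 1 - p + p * expR (- x).
  have := expR_gt0 (- x) => ex.
  have [->|pn] := eqVneq p 1; first by rewrite subrr add0r mul1r.
  by rewrite ltr_pwDl// ?mulr_ge0// ?ltW// subr_gt0 lt_neqAle pn.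
rewrite E lnM ?posrE//.
move: (ln (1 + expR (- m))) => g.
have lo : - (p * x) <= ln (1 - p + p * expR (- x)).
  rewrite -ler_expR lnK ?posrE// -[leLHS]mul1r -[leRHS]mulr1.
  rewrite [in leLHS]expRN ler_pdivrMr ?expR_gt0// mulr1 mulrDl.
  rewrite -mulrA -expRD.
  (* convexity: weights 1 - p and p at the points p x and p x - x, whose
     barycentre is 0 *)
  have h1 := expR_ge1Dx (p * x); have h2 := expR_ge1Dx (- x + p * x).
  have : (1 - p) * (1 + p * x) <= (1 - p) * expR (p * x).
    by rewrite ler_wpM2l// subr_ge0.
  have : p * (1 + (- x + p * x)) <= p * expR (- x + p * x) by rewrite ler_wpM2l.
  by move: (expR _) (expR _) => A B; nra.
have hi : ln (1 - p + p * expR (- x)) <= - (p * x) + 2 * x ^+ 2.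
  have -> : 1 - p + p * expR (- x) = 1 + p * (expR (- x) - 1) by ring.
  rewrite (le_trans (le_ln1Dx _))//; first by move: c0; lra.
  have : expR (- x) <= 1 - x + 2 * x ^+ 2.
    move: xh; rewrite ler_norml => /andP[xl xu].
    have hx := expR_ge1Dx x.
    have x1 : 0 < 1 + x by lra.
    rewrite expRN; apply: (@le_trans _ _ (1 + x)^-1).
      by rewrite lef_pV2 ?posrE ?expR_gt0.
    rewrite -[leLHS]mul1r ler_pdivrMr//.
    have : 0 <= x ^+ 2 * (1 + 2 * x) by rewrite mulr_ge0 ?sqr_ge0//; lra.
    by rewrite !expr2; nra.
  have : 0 <= x ^+ 2 by exact: sqr_ge0.
  by move: (expR (- x)) (x ^+ 2) => A B; nra.
by apply/andP; split; lra.
Qed.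

(** Integrates [ln1DexpRN_bounds]: the linear term cancels by symmetry about the
    midpoint, and only the cubic error is left. *)
Lemma softplus_prim_midpoint a h : 0 <= a -> 0 < h <= 2^-1 ->
  2 * h * ln (1 + expR (- (a + h))) <= softplus_prim (a + 2 * h) - softplus_prim a <=
  2 * h * ln (1 + expR (- (a + h))) + 4 / 3 * h ^+ 3.
Proof.
move=> a0 /andP[h0 hh]; set m := a + h.
pose g := ln (1 + expR (- m)); pose p := expR (- m) / (1 + expR (- m)).
have ab : a < a + 2 * h by lra.
have cL : {within `[a, a + 2 * h], continuous softplus_prim}.
  by apply: continuous_softplus_prim; rewrite a0.
have b x : a < x < a + 2 * h ->
    g - p * (x - m) <= ln (1 + expR (- x)) <= g - p * (x - m) + 2 * (x - m) ^+ 2.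
  move=> /andP[xa xb]; have -> : - x = - (m + (x - m)) by ring.
  by apply: ln1DexpRN_bounds => //; rewrite ler_norml /m; apply/andP; split; lra.
have dL x : a < x < a + 2 * h -> is_derive x 1 softplus_prim (ln (1 + expR (- x))).
  by move=> /andP[ax _]; apply: is_derive_softplus_prim; apply: le_lt_trans ax.
(* primitives of the two bounds: c = 0 for the tangent, c = 2 for the parabola *)
pose Q (c s : R) := g * s - p / 2 * (s - m) ^+ 2 + c / 3 * (s - m) ^+ 3.
have dQ (c x : R) : is_derive x 1 (Q c) (g - p * (x - m) + c * (x - m) ^+ 2).
  by rewrite /Q; apply: is_derive_eq; rewrite /GRing.scale/=; field.
have cQ (c : R) : {within `[a, a + 2 * h], continuous (Q c)}.
  by apply: derivable_within_continuous => x _; case: (dQ c x).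
have Qd (c : R) : Q c (a + 2 * h) - Q c a = 2 * h * g + 2 / 3 * c * h ^+ 3.
  by rewrite /Q /m; field.
apply/andP; split.
  have := @deriv_le _ (Q 0) softplus_prim _ _ a (a + 2 * h) (ltW ab)
    (fun x _ => dQ 0 x) dL
    (cQ 0) cL.
  rewrite Qd mulr0 mul0r addr0; apply => x /b/andP[+ _].
  by rewrite mul0r addr0.
have := @deriv_le _ softplus_prim (Q 2) _ _ a (a + 2 * h) (ltW ab) dL
    (fun x _ => dQ 2 x)
    cL (cQ 2).
rewrite Qd => H; rewrite (le_trans (H _))//; first by move=> x /b/andP[].
by rewrite /g; lra.
Qed.

(** Telescopes the midpoint estimate over l cells of width z/(2l) covering
    [0, z/2]; the value at 0 brings in Li2(1) = pi^2/6. *)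
Lemma sum_ln1DexpRN_bounds (z : R) l : (0 < l)%N -> 0 < z <= 2 * l%:R ->
  0 <= 2 * l%:R * Hfun z -
       2 * \sum_(0 <= i < l) ln (1 + expR (- (i.*2.+1%:R * (z / (4 * l%:R)))))
    <= z ^+ 2 / (12 * l%:R).
Proof.
move=> l0 /andP[z0 zl]; have lR : 0 < l%:R :> R by rewrite ltr0n.
pose h := z / (4 * l%:R).
have h0 : 0 < h by rewrite divr_gt0// mulr_gt0.
have hh : h <= 2^-1 by rewrite ler_pdivrMr ?mulr_gt0//; lra.
rewrite -/h; set S := \sum_(0 <= i < l) _.
have cell i : 2 * h * ln (1 + expR (- (i.*2.+1%:R * h))) <=
    softplus_prim (i.+1%:R * (2 * h)) - softplus_prim (i%:R * (2 * h)) <=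
    2 * h * ln (1 + expR (- (i.*2.+1%:R * h))) + 4 / 3 * h ^+ 3.
  have -> : i.+1%:R * (2 * h) = i%:R * (2 * h) + 2 * h by rewrite -natr1; ring.
  have -> : i.*2.+1%:R * h = i%:R * (2 * h) + h.
    by rewrite -natr1 -mul2n natrM; ring.
  apply: softplus_prim_midpoint; last by rewrite h0.
  by rewrite mulr_ge0// mulr_ge0// ltW.
have LS : \sum_(0 <= i < l)
    (softplus_prim (i.+1%:R * (2 * h)) - softplus_prim (i%:R * (2 * h))) =
    l%:R * Hfun z * 2 * h.
  rewrite (telescope_sumr (fun i => softplus_prim (i%:R * (2 * h)))) // mul0r.
  have -> : l%:R * (2 * h) = z / 2 by rewrite /h; field; rewrite gt_eqF.
  have -> : l%:R * Hfun z * 2 * h = z * Hfun z / 2.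
    by rewrite /h; field; rewrite gt_eqF.
  rewrite /softplus_prim /Hfun !mulr0 oppr0 expR0 mul1r.
  have -> : 2 * (z / 2) = z by field.
  have E x : 0 <= x -> 0 <= expR (- x) <= 1.
    by move=> x0; rewrite expR_ge0 expR_le1 oppr_le0.
  have z20 : 0 <= z / 2 by rewrite divr_ge0// ltW.
  have o01 : 0 <= (1 : R) <= 1 by rewrite ler01 lexx.
  rewrite (li2E (E _ (ltW z0))) (li2E (E _ z20)) (li2E o01) Li2_1 mulNr.
  by field; rewrite gt_eqF.
have lo : 2 * h * S <= l%:R * Hfun z * 2 * h.
  rewrite -LS mulr_sumr; apply: ler_sum => i _.
  by case/andP: (cell i).
have hi : l%:R * Hfun z * 2 * h <= 2 * h * S + l%:R * (4 / 3 * h ^+ 3).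
  have -> : l%:R * (4 / 3 * h ^+ 3) = \sum_(0 <= i < l) (4 / 3 * h ^+ 3).
    by rewrite sumr_const_nat subn0 mulr_natl.
  rewrite -LS mulr_sumr -big_split; apply: ler_sum => i _.
  by case/andP: (cell i).
have c1 : 2 * S <= 2 * l%:R * Hfun z.
  by rewrite -(ler_pM2r h0); lra.
have c2 : 2 * l%:R * Hfun z <= 2 * S + l%:R * (4 / 3 * h ^+ 2).
  by rewrite -(ler_pM2r h0); lra.
apply/andP; split; first by lra.
have -> : z ^+ 2 / (12 * l%:R) = l%:R * (4 / 3 * h ^+ 2).
  by rewrite /h; field; rewrite gt_eqF.
by lra.
Qed.

Lemma cvg_theta_product (z : R) : 0 < z ->
  \prod_(1 <= i < l.+1) (1 + expR (- z / l.*2%:R / 2) ^+ i.*2.-1) ^+ 2 /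
    expR (l.*2%:R * Hfun z) @[l --> \oo] --> (1 : R).
Proof.
move=> z0.
pose T l := \sum_(0 <= i < l) ln (1 + expR (- (i.*2.+1%:R * (z / (4 * l%:R))))).
have E l : (0 < l)%N ->
    \prod_(1 <= i < l.+1) (1 + expR (- z / l.*2%:R / 2) ^+ i.*2.-1) ^+ 2 /
      expR (l.*2%:R * Hfun z) = expR (- (2 * l%:R * Hfun z - 2 * T l)).
  move=> l0; have lR : 0 < l%:R :> R by rewrite ltr0n.
  rewrite opprB expRB -mul2n natrM; congr (_ / _).
  rewrite big_add1/= /T mulr_sumr expR_sum; apply: eq_bigr => i _.
  rewrite expRM_natl lnK ?posrE ?addr_gt0 ?expR_gt0//; congr ((1 + _) ^+ 2).
  rewrite -expRM_natl; congr expR. 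
  by field; rewrite gt_eqF.
rewrite -[X in _ --> X]expR0 -[X in expR X]oppr0.
apply: (@cvg_trans _ (expR (- (2 * l%:R * Hfun z - 2 * T l)) @[l --> \oo])).
  by apply: near_eq_cvg; near=> l; rewrite E//; near: l; exact: nbhs_infty_gt.
apply: cvg_expR_comp; apply: cvgN.
apply: (@squeeze_cvgr _ _ _ _ (fun=> 0) (fun l => z ^+ 2 / 12 * l%:R^-1)).
- near=> l; rewrite (_ : _ / 12 / _ = z ^+ 2 / (12 * l%:R)); last first.
    by rewrite invfM mulrA.
  apply: sum_ln1DexpRN_bounds; first by near: l; exact: nbhs_infty_gt.
  have zl : z <= l%:R by near: l; exact: nbhs_infty_ger.
  by rewrite z0/=; lra.
- exact: cvg_cst.
- rewrite -[X in _ --> X](mulr0 (z ^+ 2 / 12)); apply: cvgM; first exact: cvg_cst.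
  apply/gtr0_cvgV0; last exact: cvgr_idn.
  by near=> l; rewrite ltr0n; near: l; exact: nbhs_infty_gt.
Unshelve. all: by end_near. Qed.

End Dilogarithm.

(** * Logarithm of a factor around the centre *)

Section LocalExpansion.
Variables (R : realType) (z : R).
Hypothesis z0 : 0 < z.
Implicit Types (h t y e x : R).

Let w := expR (z / 2).

Let w1 : 1 < w.
Proof. by rewrite expR_gt1 divr_gt0. Qed.

Let w0 : 0 < w.
Proof. exact: expR_gt0. Qed.

Lemma AfunE : Afun z = 2 * z / (w - 1).
Proof.
rewrite /Afun /coth /cosh /sinh.
have v1 : 1 < expR (z / 4) by rewrite expR_gt1 divr_gt0.
have -> : w = expR (z / 4) ^+ 2 by rewrite -expRM_natl; congr expR; field.
rewrite expRN; move: (expR (z / 4)) v1 => v v1.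
field; apply/andP; split; first by rewrite gt_eqF; nra.
by rewrite gt_eqF; nra.
Qed.

Lemma BfunE : Bfun z = z ^+ 3 * w * (w + 1) / (w - 1) ^+ 3.
Proof.
rewrite /Bfun /sinh.
have v1 : 1 < expR (z / 4) by rewrite expR_gt1 divr_gt0.
have -> : expR (- (z / 2)) = expR (z / 4) ^- 2.
  by rewrite -expRM_natl -expRN; congr expR; field.
have wE : w = expR (z / 4) ^+ 2 by rewrite -expRM_natl; congr expR; field.
rewrite -/w wE expRN; move: (expR (z / 4)) v1 => v v1.
field; apply/andP; split; first by rewrite gt_eqF; nra.
by rewrite gt_eqF; nra.
Qed.

Lemma Bfun_gt0 : 0 < Bfun z.
Proof.
rewrite BfunE divr_gt0//; last by rewrite exprn_gt0// subr_gt0.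
by rewrite mulr_gt0// ?addr_gt0// mulr_gt0// exprn_gt0.
Qed.

Lemma Afun_gt0 : 0 < Afun z.
Proof. by rewrite AfunE divr_gt0// ?subr_gt0// mulr_gt0. Qed.

(** For r = exp(-z/n) this is ln(1 - r^a) at t = a/n. *)
Definition log_factor t := ln (1 - expR (- (z * t))).

Lemma log_factor_arg_gt0 t : 0 < t -> 0 < 1 - expR (- (z * t)).
Proof. by move=> t0; rewrite subr_gt0 expR_lt1 oppr_lt0 mulr_gt0. Qed.

Lemma log_factor_nd t t' : 0 < t -> t <= t' -> log_factor t <= log_factor t'.
Proof.
move=> t0 tt'; rewrite /log_factor ler_ln ?posrE ?log_factor_arg_gt0//; last first.
  exact: lt_le_trans tt'.
by rewrite lerB// ler_expR lerN2 ler_pM2l.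
Qed.

Lemma is_derive_log_factor t : 0 < t ->
  is_derive t 1 log_factor (z * expR (- (z * t)) / (1 - expR (- (z * t)))).
Proof.
move=> t0; have p0 := log_factor_arg_gt0 t0.
have d2 : is_derive t 1 (fun s => - (z * s)) (- z).
  by apply: is_derive_eq; rewrite /GRing.scale/=; ring.
have d3 : is_derive t 1 (expR \o (fun s => - (z * s))) (expR (- (z * t)) * - z).
  exact: is_derive1_comp.
have d4 : is_derive t 1 (fun s => 1 - (expR \o (fun s => - (z * s))) s)
   (0 - expR (- (z * t)) * - z).
  exact: is_deriveB.
have d5 := is_derive1_ln p0.
have d6 : is_derive t 1 (@ln R \o (fun s => 1 - (expR \o (fun s => - (z * s))) s))
   ((1 - expR (- (z * t)))^-1 * (0 - expR (- (z * t)) * - z)).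
  exact: is_derive1_comp.
by apply: is_derive_eq; rewrite mulrC mulrN sub0r opprK [X in X / _]mulrC.
Qed.

(** By [AfunE] the coefficient Afun z is twice the derivative of [log_factor z]
    at 1/2, so this is the remainder of an odd function after its linear part. *)
Definition odd_defect h :=
  log_factor (1 / 2 + h) - log_factor (1 / 2 - h) - Afun z * h.

Let q y := z * w * (w + 1) / ((w - y) * (w * y - 1) * (w - 1)).

(** With w = exp(z/2) and y = exp(zh), the sum of the derivatives of [log_factor z]
    at 1/2 + h and 1/2 - h minus twice the derivative at 1/2 is
    z/(wy-1) + z/(w/y-1) - 2z/(w-1), a rational function of y with a double zero
    at y = 1. *)
Lemma is_derive_odd_defect h : 0 <= h < 1 / 2 ->
  is_derive h 1 odd_defect (q (expR (z * h)) * (expR (z * h) - 1) ^+ 2).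
Proof.
move=> /andP[h0 h1].
have hp : 0 < 1 / 2 + h by lra.
have hm : 0 < 1 / 2 - h by lra.
have dp := is_derive_log_factor hp; have dm := is_derive_log_factor hm.
pose gp s : R := 1 / 2 + s; pose gm s : R := 1 / 2 - s.
have ap : is_derive h 1 gp 1 by apply: is_derive_eq; ring.
have am : is_derive h 1 gm (-1) by apply: is_derive_eq; ring.
have cp := @is_derive1_comp _ log_factor gp h _ _ dp ap.
have cm := @is_derive1_comp _ log_factor gm h _ _ dm am.
have cA : is_derive h 1 (fun s => Afun z * s) (Afun z).
  by apply: is_derive_eq; rewrite /GRing.scale/= mulr1.
have -> : odd_defect = (log_factor \o gp) - (log_factor \o gm) -
    (fun s => Afun z * s) by [].
apply: is_derive_eq; rewrite AfunE /q.
have y1 : 1 <= expR (z * h) by rewrite -expR0 ler_expR mulr_ge0// ltW.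
have yw : expR (z * h) < w by rewrite ltr_expR ltr_pM2l//; lra.
have -> : expR (- (z * (1 / 2 + h))) = (w * expR (z * h))^-1.
  by rewrite -expRD -expRN; congr expR; field.
have -> : expR (- (z * (1 / 2 - h))) = expR (z * h) / w.
  by rewrite -expRB; congr expR; field.
move: w w1 (expR (z * h)) y1 yw => W W1 y y1 yw.
have W0 : W != 0 by rewrite gt_eqF; lra.
have y0 : y != 0 by rewrite gt_eqF; lra.
have a1 : W - 1 != 0 by rewrite gt_eqF; lra.
have a2 : W - y != 0 by rewrite gt_eqF; lra.
have a3 : W * y - 1 != 0 by rewrite gt_eqF; nra.
by field; rewrite W0 y0 a1 a2 a3.
Qed.

Lemma odd_defect0 : odd_defect 0 = 0.
Proof. by rewrite /odd_defect addr0 subr0 subrr mulr0 subr0. Qed.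

Let continuous_odd_defect h : 0 <= h < 1 / 2 -> 
  {within `[0, h], continuous odd_defect}.
Proof.
move=> /andP[h0 h1]; apply: derivable_within_continuous => x.
rewrite in_itv/= => /andP[x0 xh].
have xx : 0 <= x < 1 / 2 by rewrite x0 (le_lt_trans xh).
by case: (is_derive_odd_defect xx).
Qed.

Let is_derive_cube (c x : R) : is_derive x 1 (fun h => c * h ^+ 3) (3 * c * x ^+ 2).
Proof. by apply: is_derive_eq; rewrite /GRing.scale/=; ring. Qed.

Let continuous_cube (c h : R) : {within `[0, h], continuous (fun h => c * h ^+ 3)}.
Proof.
by apply: derivable_within_continuous => x _; case: (is_derive_cube c x).
Qed.

Let odd_defect_ge_cube c h : 0 <= h < 1 / 2 ->
  (forall x, 0 < x < h ->
     3 * c * x ^+ 2 <= q (expR (z * x)) * (expR (z * x) - 1) ^+ 2) ->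
  c * h ^+ 3 <= odd_defect h.
Proof.
move=> hh cb; have [h0 h1] := andP hh.
have := @deriv_le _ (fun h => c * h ^+ 3) odd_defect (fun x => 3 * c * x ^+ 2)
  (fun x => q (expR (z * x)) * (expR (z * x) - 1) ^+ 2) 0 h h0.
rewrite odd_defect0 expr0n mulr0 !subr0; apply => //.
- move=> x /andP[x0 xh]; apply: is_derive_odd_defect.
  by rewrite ltW//= (lt_trans xh).
- exact: continuous_odd_defect.
Qed.

Let odd_defect_le_cube c h : 0 <= h < 1 / 2 ->
  (forall x, 0 < x < h ->
     q (expR (z * x)) * (expR (z * x) - 1) ^+ 2 <= 3 * c * x ^+ 2) ->
  odd_defect h <= c * h ^+ 3.
Proof.
move=> hh cb; have [h0 h1] := andP hh.
have := @deriv_le _ odd_defect (fun h => c * h ^+ 3)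
  (fun x => q (expR (z * x)) * (expR (z * x) - 1) ^+ 2)
  (fun x => 3 * c * x ^+ 2) 0 h h0.
rewrite odd_defect0 expr0n mulr0 !subr0; apply => //.
- move=> x /andP[x0 xh]; apply: is_derive_odd_defect.
  by rewrite ltW//= (lt_trans xh).
- exact: continuous_odd_defect.
Qed.

Let expRM_bounds x : 0 <= x ->
  z * x <= expR (z * x) - 1 <= z * x * expR (z * x).
Proof.
move=> x0; rewrite lerBrDl expR_ge1Dx/=.
have := expR_ge1Dx (- (z * x)).
rewrite -(ler_pM2r (expR_gt0 (z * x))) -expRD addNr expR0.
by lra.
Qed.

Let q_gt0 y : 1 <= y < w -> 0 < q y.
Proof.
move=> /andP[y1 yw]; rewrite /q divr_gt0//.
  by rewrite mulr_gt0// ?addr_gt0// mulr_gt0.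
rewrite mulr_gt0// ?subr_gt0// mulr_gt0// subr_gt0//.
by rewrite (lt_le_trans w1)// ler_peMr// ltW.
Qed.

Let expRM_itv x : 0 <= x < 1 / 2 -> 1 <= expR (z * x) < w.
Proof.
move=> /andP[x0 x1]; rewrite -{1}expR0 ler_expR mulr_ge0 ?(ltW z0)//=.
by rewrite ltr_expR ltr_pM2l//; lra.
Qed.

(** From z x <= y - 1 <= z x y, with y = exp(z x). *)
Let odd_defect_deriv_bounds x : 0 <= x < 1 / 2 -> let y := expR (z * x) in
  (z ^+ 2 * q y * x ^+ 2 <= q y * (y - 1) ^+ 2) /\
  (q y * (y - 1) ^+ 2 <= z ^+ 2 * y ^+ 2 * q y * x ^+ 2).
Proof.
move=> xh y; have /andP[x0 x1] := xh.
have := expRM_bounds x0; rewrite -/y => /andP[lo hi].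
have qy : 0 < q y by apply: q_gt0; exact: expRM_itv.
have y1 : 0 <= y - 1 by rewrite subr_ge0; case/andP: (expRM_itv xh).
have zx : 0 <= z * x by rewrite mulr_ge0// ltW.
split.
  rewrite mulrAC mulrC ler_pM2l// -exprMn lerXn2r ?nnegrE//.
have -> : z ^+ 2 * y ^+ 2 * q y * x ^+ 2 = q y * (z * x * y) ^+ 2 by ring.
by rewrite ler_pM2l// lerXn2r ?nnegrE// (le_trans y1).
Qed.

(** A third of a lower bound for the derivative of [odd_defect] divided by h^2 on
    ]0, 1/2[, obtained from w - y <= w, w y - 1 <= w^2 and y - 1 >= z h. *)
Definition defect_const : R := z ^+ 3 * (w + 1) / (3 * w ^+ 2 * (w - 1)).

Lemma defect_const_gt0 : 0 < defect_const.
Proof.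
rewrite divr_gt0// mulr_gt0 ?subr_gt0// ?addr_gt0// ?exprn_gt0//.
by rewrite mulr_gt0// exprn_gt0.
Qed.

Lemma odd_defect_ge h : 0 <= h < 1 / 2 -> defect_const * h ^+ 3 <= odd_defect h.
Proof.
move=> hh; apply: odd_defect_ge_cube => // x /andP[x0 xh].
have xx : 0 <= x < 1 / 2 by case/andP: hh => _ h1; rewrite ltW//= (lt_trans xh).
case: (odd_defect_deriv_bounds xx) => + _; apply: le_trans.
rewrite ler_wpM2r ?sqr_ge0//.
have := expRM_itv xx; move: (expR _) => y /andP[y1 yw].
have -> : 3 * defect_const = z ^+ 2 * (z * w * (w + 1) / (w * w ^+ 2 * (w - 1))).
  rewrite /defect_const; move: w w0 w1 => W W0 W1; field.
  by rewrite !gt_eqF//; lra.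
rewrite ler_wpM2l ?sqr_ge0// /q ler_wpM2l//.
  by rewrite mulr_ge0// ?addr_ge0// ?mulr_ge0// ltW.
rewrite lef_pV2 ?posrE.
- apply: ler_wpM2r; first by rewrite subr_ge0 ltW.
  apply: ler_pM.
  + by rewrite subr_ge0 ltW.
  + by move: w1 w0; nra.
  + by move: w1 w0; lra.
  + by move: w1 w0; rewrite expr2; nra.
- by rewrite mulr_gt0 ?subr_gt0// mulr_gt0// exprn_gt0.
- rewrite mulr_gt0 ?subr_gt0// mulr_gt0 ?subr_gt0//.
  by rewrite (lt_le_trans w1)// ler_peMr// ltW.
Qed.

(** Third order Taylor expansion: the derivative divided by h^2 tends to Bfun z. *)
Lemma odd_defect_asymp e : 0 < e ->
  exists2 d : R, 0 < d < 1 / 2 &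
    forall h, 0 <= h <= d -> `|odd_defect h - Bfun z / 3 * h ^+ 3| <= e * h ^+ 3.
Proof.
move=> e0.
have cy : expR (z * x) @[x --> (0:R)] --> (1 : R).
  rewrite -expR0; apply: cvg_expR_comp; rewrite -[X in _ --> X](mulr0 z).
  by apply: cvgM; [exact: cvg_cst|exact: cvg_id].
have cq : q (expR (z * x)) @[x --> (0:R)] --> q 1.
  rewrite /q; apply: cvgM; first exact: cvg_cst.
  apply: cvgV; first by rewrite !mulf_neq0 ?mulr1// gt_eqF ?subr_gt0.
  apply: cvgM; last exact: cvg_cst.
  apply: cvgM; apply: cvgB => //; try exact: cvg_cst.
  by apply: cvgM => //; exact: cvg_cst.
have qB : z ^+ 2 * q 1 = Bfun z.
  rewrite BfunE /q mulr1; move: w w1 => W W1; field.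
  by rewrite gt_eqF//; lra.
have c1 : z ^+ 2 * q (expR (z * x)) @[x --> (0:R)] --> Bfun z.
  by rewrite -qB; apply: cvgM => //; exact: cvg_cst.
have c2 : z ^+ 2 * expR (z * x) ^+ 2 * q (expR (z * x)) @[x --> (0:R)] --> Bfun z.
  rewrite -qB -[z ^+ 2 in X in _ --> X]mulr1 -[X in _ * X * _](expr1n _ 2).
  apply: cvgM => //; apply: cvgM; first exact: cvg_cst.
  exact: cvgrX.
have e3 : 0 < 3 * e by rewrite mulr_gt0.
move/cvgrPdist_le: c1 => /(_ _ e3) /nbhs_ballP[d1 /= d10 b1].
move/cvgrPdist_le: c2 => /(_ _ e3) /nbhs_ballP[d2 /= d20 b2].
pose d := Num.min (1 / 4) (Num.min (d1 / 2) (d2 / 2)).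
have d0 : 0 < d by rewrite !lt_min !divr_gt0.
have [k1 k2 k3] : [/\ d <= 1 / 4, d <= d1 / 2 & d <= d2 / 2].
  by split; rewrite !ge_min lexx ?orbT.
exists d; first by rewrite d0/=; lra.
move=> h /andP[h0 hd].
have hh : 0 <= h < 1 / 2 by rewrite h0/=; lra.
have lo : (Bfun z / 3 - e) * h ^+ 3 <= odd_defect h.
  apply: odd_defect_ge_cube => // x /andP[x0 xh].
  have xx : 0 <= x < 1 / 2 by apply/andP; split; lra.
  case: (odd_defect_deriv_bounds xx) => + _; apply: le_trans.
  rewrite ler_wpM2r ?sqr_ge0//.
  have := b1 x; rewrite /ball/= sub0r normrN gtr0_norm//.
  by move=> /(_ ltac:(lra)); rewrite ler_norml => /andP[? ?]; lra.
have hi : odd_defect h <= (Bfun z / 3 + e) * h ^+ 3.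
  apply: odd_defect_le_cube => // x /andP[x0 xh].
  have xx : 0 <= x < 1 / 2 by apply/andP; split; lra.
  case: (odd_defect_deriv_bounds xx) => _; move=> /le_trans; apply.
  rewrite ler_wpM2r ?sqr_ge0//.
  have := b2 x; rewrite /ball/= sub0r normrN gtr0_norm//.
  by move=> /(_ ltac:(lra)); rewrite ler_norml => /andP[? ?]; lra.
by rewrite ler_norml; apply/andP; split; lra.
Qed.
End LocalExpansion.

(** * Ratios to the central Gaussian binomial *)

Section CentralRatio.
Variables (R : realType) (z : R).
Hypothesis z0 : 0 < z.
Implicit Types (l n k i j : nat).

Let r l : R := expR (- z / l.*2%:R).

Lemma expRX_lt1 (x : R) k : x < 0 -> (0 < k)%N -> expR x ^+ k < 1.
Proof.
by move=> x0 k0; rewrite -expRM_natl expR_lt1 pmulr_rlt0// ltr0n.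
Qed.

Lemma qfact_gt0 (s : R) n : 0 <= s < 1 -> 0 < qfact s n.
Proof.
move=> /andP[s0 s1]; elim: n => [|n IHn]; first by rewrite qfact0.
by rewrite qfactS mulr_gt0// subr_gt0 exprn_ilt1.
Qed.

Lemma gbinom_gt0 (s : R) n k : 0 <= s < 1 -> 0 < gbinom s n k.
Proof. by move=> s01; rewrite divr_gt0 ?mulr_gt0 ?qfact_gt0. Qed.

Let r01 l : (0 < l)%N -> 0 <= r l < 1.
Proof.
move=> l0; rewrite expR_ge0/= expR_lt1 mulNr oppr_lt0 divr_gt0// ltr0n.
by rewrite double_gt0.
Qed.

Let rX l k (t : R) : (0 < l)%N -> t = k%:R / l.*2%:R ->
  r l ^+ k = expR (- (z * t)).
Proof. by move=> l0 ->; rewrite -expRM_natl; congr expR; ring. Qed.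

Definition central_ratio l j : R := gbinom (r l) l.*2 (l + j) / gbinom (r l) l.*2 l.

(** Consecutive Gaussian binomials have the ratio (1 - r^(n-k))/(1 - r^(k+1)). *)
Lemma central_ratioE l j : (j <= l)%N -> (0 < l)%N ->
  central_ratio l j = expR (\sum_(0 <= i < j)
     (log_factor z (1 / 2 - i%:R / l.*2%:R) -
      log_factor z (1 / 2 + i.+1%:R / l.*2%:R))).
Proof.
move=> jl l0; have nR : 0 < l.*2%:R :> R by rewrite ltr0n double_gt0.
have n2 : l%:R = l.*2%:R / 2 :> R by rewrite -mul2n natrM; field.
have g0 n k := gbinom_gt0 n k (r01 l0).
elim: j jl => [|j IHj] jl.
  by rewrite big_nil expR0 /central_ratio addn0 divff// gt_eqF.
rewrite big_nat_recr//= expRD -IHj ?(ltnW jl)// expRB.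
have jR : j%:R < l%:R :> R by rewrite ltr_nat.
have a1 : 0 < 1 / 2 - j%:R / l.*2%:R :> R.
  by rewrite subr_gt0 ltr_pdivrMr// mulrAC mul1r -n2.
have a2 : 0 < 1 / 2 + j.+1%:R / l.*2%:R :> R.
  by rewrite addr_gt0// divr_gt0.
rewrite /log_factor !lnK ?posrE ?log_factor_arg_gt0//.
rewrite -(@rX l (l - j)) ?natrB ?(ltnW jl)//; last by rewrite n2; field; rewrite gt_eqF.
rewrite -(@rX l (l + j.+1))//; last by rewrite natrD n2; field; rewrite gt_eqF.
have q0 n := qfact_gt0 n (r01 l0).
rewrite /central_ratio [RHS]mulrAC; congr (_ / _).
rewrite /gbinom addnS qfactS -addnn.
have -> : (l + l - (l + j).+1 = l - j.+1)%N by lia.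
have -> : (l + l - (l + j) = (l - j.+1).+1)%N by lia.
have -> : (l - j = (l - j.+1).+1)%N by lia.
rewrite qfactS.
have x1 : 0 < 1 - r l ^+ (l - j.+1).+1.
  by rewrite subr_gt0 exprn_ilt1//; case/andP: (r01 l0).
have x2 : 0 < 1 - r l ^+ (l + j).+1.
  by rewrite subr_gt0 exprn_ilt1//; case/andP: (r01 l0).
have := q0 (l + l)%N; have := q0 (l + j)%N; have := q0 (l - j.+1)%N.
move: (qfact _ _) (qfact _ _) (qfact _ _) (1 - _) (1 - _) x1 x2.
by move=> a b c d e d0 e0 a0 b0 c0; field; rewrite !gt_eqF.
Qed.

(** The tilt removes the quadratic part of the logarithm of [central_ratio]. *)
Definition tilted_ratio l j : R :=
  central_ratio l j * expR (Afun z / 2 * (j%:R ^+ 2 / l.*2%:R)).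

Lemma sum_cubes j : (4 * \sum_(0 <= i < j) i ^ 3 = (j * j.-1) ^ 2)%N.
Proof.
elim: j => [|j IHj]; first by rewrite big_nil.
by rewrite big_nat_recr//= mulnDr IHj; case: j {IHj} => // j; nia.
Qed.

Lemma sum_id j : (2 * \sum_(0 <= i < j) i = j * j.-1)%N.
Proof.
elim: j => [|j IHj]; first by rewrite big_nil.
by rewrite big_nat_recr//= mulnDr IHj; case: j {IHj} => // j; nia.
Qed.

(** Since [log_factor z] is nondecreasing, log_factor z (1/2 + (i+1)/n) may be
    replaced by log_factor z (1/2 + i/n).  This makes the arguments symmetric
    about 1/2 and keeps them in ]0, 1[ up to j = l.  The price is a term
    A j/(2n) <= A/4, and the bound on the odd defect does the rest. *)
Lemma tilted_ratio_le l j : (j <= l)%N -> (0 < l)%N ->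
  tilted_ratio l j <= expR (Afun z / 4 + defect_const z) *
              expR (- (defect_const z / 16 * (j%:R ^+ 4 / l.*2%:R ^+ 3))).
Proof.
move=> jl l0; have nR : 0 < l.*2%:R :> R by rewrite ltr0n double_gt0.
have n1 : 1 <= l.*2%:R :> R by rewrite ler1n double_gt0.
have n2 : l%:R = l.*2%:R / 2 :> R by rewrite -mul2n natrM; field.
rewrite /tilted_ratio central_ratioE// -!expRD ler_expR.
set n := l.*2%:R in nR n1 n2 *.
have A0 := Afun_gt0 z0; have b0 := defect_const_gt0 z0.
have term i : (i < j)%N ->
    log_factor z (1 / 2 - i%:R / n) - log_factor z (1 / 2 + i.+1%:R / n) <=
    - (Afun z / n * i%:R) - defect_const z / n ^+ 3 * i%:R ^+ 3.
  move=> ij; have iR : i%:R < l%:R :> R by rewrite ltr_nat; exact: leq_trans jl.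
  have h1 : 0 <= i%:R / n < 1 / 2.
    by rewrite divr_ge0 ?(ltW nR)//= ltr_pdivrMr// mulrAC mul1r -n2.
  have := odd_defect_ge z0 h1; rewrite /odd_defect.
  have : log_factor z (1 / 2 + i%:R / n) <= log_factor z (1 / 2 + i.+1%:R / n).
    apply: log_factor_nd => //; first by case/andP: h1 => ? _; lra.
    by rewrite lerD2l ler_pM2r ?invr_gt0// ler_nat.
  have -> : defect_const z * (i%:R / n) ^+ 3 = defect_const z / n ^+ 3 * i%:R ^+ 3.
    by field; rewrite gt_eqF.
  have -> : Afun z * (i%:R / n) = Afun z / n * i%:R by field; rewrite gt_eqF.
  by lra.
have {}term : \sum_(0 <= i < j)
    (log_factor z (1 / 2 - i%:R / n) - log_factor z (1 / 2 + i.+1%:R / n)) <=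
    - (Afun z / n * (\sum_(0 <= i < j) i)%:R) -
    defect_const z / n ^+ 3 * (\sum_(0 <= i < j) i ^ 3)%:R.
  rewrite !natr_sum !mulr_sumr -!sumrN -big_split/= !big_nat.
  by apply: ler_sum => i /andP[_ ij]; rewrite natrX; exact: term.
apply: le_trans (lerD term (lexx _)) _.
have s1 : (\sum_(0 <= i < j) i)%:R = (j%:R ^+ 2 - j%:R) / 2 :> R.
  have := congr1 (fun m => m%:R : R) (sum_id j); rewrite /= natrM.
  move: (\sum_(_ <= _ < _) _)%N => S; case: (j) => [|k] /=.
    by rewrite muln0; lra.
  by rewrite natrM -[k.+1%:R]natr1 => ?; lra.
(* the sum is (j(j-1)/2)^2, and j - 1 >= j/2 for j >= 2; the - 1 covers j = 1 *)
have s3 : (j%:R ^+ 4 / 16 - 1 : R) <= (\sum_(0 <= i < j) i ^ 3)%:R.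
  have := sum_cubes j; move: (\sum_(_ <= _ < _) _)%N => S SE.
  have : (j ^ 4 <= 16 * (S + 1))%N.
    case: j {jl term s1} SE => [|[|k]] SE //; first by nia.
    by move: SE => /=; nia.
  by rewrite -(ler_nat R) natrX natrM natrD; lra.
have jn : j%:R <= n / 2 by rewrite -n2 ler_nat.
have : defect_const z / n ^+ 3 * (j%:R ^+ 4 / 16 - 1) <=
       defect_const z / n ^+ 3 * (\sum_(0 <= i < j) i ^ 3)%:R.
  by rewrite ler_pM2l// divr_gt0// exprn_gt0.
rewrite s1; have : defect_const z / n ^+ 3 <= defect_const z.
  by rewrite ler_piMr ?(ltW b0)// invf_le1 ?exprn_gt0// exprn_ege1.
have : Afun z / n * j%:R <= Afun z / 2.
  have -> : Afun z / 2 = Afun z / n * (n / 2) by field; rewrite gt_eqF.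
  by rewrite ler_pM2l// divr_gt0.
have -> : defect_const z / 16 * (j%:R ^+ 4 / n ^+ 3) =
          defect_const z / n ^+ 3 * (j%:R ^+ 4 / 16) by field; rewrite gt_eqF.
have -> : Afun z / 2 * (j%:R ^+ 2 / n) = Afun z / n * j%:R ^+ 2 / 2.
  by field; rewrite gt_eqF.
move: (defect_const z / n ^+ 3) (Afun z / n) (_%:R) => F A' S.
by lra.
Qed.


(** Here the arguments are shifted on the other side of 1/2, by telescoping, so
    that the identity is exact; both correction terms vanish as j/n tends to 0. *)
Lemma tilted_ratioE l j : (j < l)%N ->
  tilted_ratio l j = expR (- (\sum_(0 <= i < j) odd_defect z (i.+1%:R / l.*2%:R)) -
    Afun z / 2 * (j%:R / l.*2%:R) +
    (log_factor z (1 / 2) - log_factor z (1 / 2 - j%:R / l.*2%:R))).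
Proof.
move=> jl; have l0 : (0 < l)%N by exact: leq_ltn_trans jl.
have nR : 0 < l.*2%:R :> R by rewrite ltr0n double_gt0.
rewrite /tilted_ratio central_ratioE ?(ltnW jl)// -expRD; congr expR.
set n := l.*2%:R in nR *.
have -> : log_factor z (1 / 2) - log_factor z (1 / 2 - j%:R / n) =
    - \sum_(0 <= i < j)
      (log_factor z (1 / 2 - i.+1%:R / n) - log_factor z (1 / 2 - i%:R / n)).
  rewrite (telescope_sumr (fun i => log_factor z (1 / 2 - i%:R / n)))//.
  by rewrite mul0r subr0 opprB.
have -> : Afun z / 2 * (j%:R ^+ 2 / n) =
    \sum_(0 <= i < j) (Afun z * (i.+1%:R / n)) - Afun z / 2 * (j%:R / n).
  rewrite -mulr_sumr -mulr_suml -natr_sum.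
  have -> : (\sum_(0 <= i < j) i.+1)%:R = (j%:R ^+ 2 + j%:R) / 2 :> R.
    have := congr1 (fun m => m%:R : R) (sum_id j.+1).
    rewrite /= natrM big_nat_recl// add0n.
    move: (\sum_(_ <= _ < _) _)%N => S; rewrite natrM -[j.+1%:R]natr1 => ?; lra.
  by field; rewrite gt_eqF.
rewrite addrA [RHS]addrAC; congr (_ - _).
rewrite -!sumrN -!big_split/=; apply: eq_bigr => i _; rewrite /odd_defect; ring.
Qed.

(** The sum of the odd defects is asymptotic to B/3 times the sum of the
    (i/n)^3 for i <= j, and the latter is (j(j+1))^2/(4 n^3). *)
Lemma cvg_tilted_ratio (j_ : nat -> nat) (X : R) :
  (j_ l)%:R / l.*2%:R @[l --> \oo] --> (0 : R) ->
  (j_ l)%:R ^+ 4 / l.*2%:R ^+ 3 @[l --> \oo] --> X ->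
  tilted_ratio l (j_ l) @[l --> \oo] --> expR (- (Bfun z / 12 * X)).
Proof.
move=> j0 jX.
have n0 : \forall l \near \oo, 0 < l.*2%:R :> R.
  by near=> l; rewrite ltr0n double_gt0; near: l; exact: nbhs_infty_gt.
have jsmall (d : R) : 0 < d -> \forall l \near \oo, (j_ l)%:R / l.*2%:R <= d.
  move=> d0; move/cvgrPdist_le : (j0) => /(_ _ d0); apply: filterS => l.
  by rewrite sub0r normrN ger0_norm// divr_ge0.
pose T l : R := \sum_(0 <= i < j_ l) (i.+1%:R / l.*2%:R) ^+ 3.
have cT : T l @[l --> \oo] --> X / 4.
  have vn : l.*2%:R^-1 @[l --> \oo] --> (0 : R).
    apply/gtr0_cvgV0; first exact: n0.
    apply/cvgryPge => M; near=> l.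
    rewrite (@le_trans _ _ l%:R)//; last by rewrite ler_nat -addnn leq_addr.
    by near: l; exact: nbhs_infty_ger.
  have cX : ((j_ l)%:R ^+ 4 / l.*2%:R ^+ 3 + 2 * ((j_ l)%:R / l.*2%:R) ^+ 3 +
      ((j_ l)%:R / l.*2%:R) ^+ 2 * l.*2%:R^-1) / 4 @[l --> \oo] -->
      (X + 2 * 0 ^+ 3 + 0 ^+ 2 * 0) / 4.
    apply: cvgM; last exact: cvg_cst.
    apply: cvgD; last by apply: cvgM => //; exact: cvgrX.
    apply: cvgD => //; apply: cvgM; first exact: cvg_cst.
    exact: cvgrX.
  rewrite !expr0n/= mulr0 mul0r !addr0 in cX.
  apply: cvg_trans cX; apply: near_eq_cvg; near=> l => /=.
  have nR : 0 < l.*2%:R :> R by near: l.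
  rewrite /T; set n := l.*2%:R in nR *.
  under [RHS]eq_bigr do rewrite expr_div_n -natrX.
  rewrite -mulr_suml -natr_sum.
  have -> : (\sum_(0 <= i < j_ l) i.+1 ^ 3)%:R =
      ((j_ l)%:R * ((j_ l)%:R + 1)) ^+ 2 / 4 :> R.
    have := congr1 (fun m => m%:R : R) (sum_cubes (j_ l).+1).
    rewrite /= natrM big_nat_recl// add0n.
    move: (\sum_(_ <= _ < _) _)%N => S.
    rewrite natrX natrM -[(j_ l).+1%:R]natr1 => ?; lra.
  by field; rewrite gt_eqF.
pose S l : R := \sum_(0 <= i < j_ l) odd_defect z (i.+1%:R / l.*2%:R).
have cS : S l @[l --> \oo] --> Bfun z / 12 * X.
  have -> : Bfun z / 12 * X = Bfun z / 3 * (X / 4) + 0 by rewrite addr0; field.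
  have SE : S = (fun l => Bfun z / 3 * T l + (S l - Bfun z / 3 * T l)).
    by apply/funext => l; rewrite addrC subrK.
  rewrite SE; apply: cvgD; first by apply: cvgM => //; exact: cvg_cst.
  apply/cvgr0Pnorm_le => e e0.
  have X0 : 0 < `|X| + 1 by rewrite ltr_pwDr.
  have [d /andP[d0 d1] hd] := odd_defect_asymp z0 (divr_gt0 e0 X0).
  near=> l.
  have nR : 0 < l.*2%:R :> R by near: l.
  have jd : (j_ l)%:R / l.*2%:R <= d by near: l; exact: jsmall.
  have TX : T l <= `|X| + 1.
    have : `|X / 4 - T l| <= 1 / 2 by near: l; move/cvgrPdist_le: cT; apply.
    have := ler_norm X; have := normr_ge0 X.
    by rewrite ler_norml => ? ? /andP[? ?]; lra.
  rewrite /S /T mulr_sumr -sumrB (le_trans (ler_norm_sum _ _ _))//.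
  apply: (@le_trans _ _ (e / (`|X| + 1) * T l)); last first.
    by rewrite mulrAC ler_pdivrMr// ler_pM2l.
  rewrite /T mulr_sumr !big_nat; apply: ler_sum => i /andP[_ ij].
  apply: hd; rewrite divr_ge0//= (le_trans _ jd)//.
  by rewrite ler_pM2r ?invr_gt0// ler_nat.
have cphi : log_factor z (1 / 2 - (j_ l)%:R / l.*2%:R) @[l --> \oo] -->
    log_factor z (1 / 2).
  have ca : 1 / 2 - (j_ l)%:R / l.*2%:R @[l --> \oo] --> (1 / 2 - 0 : R).
    by apply: cvgB => //; exact: cvg_cst.
  rewrite subr0 in ca; apply: (cvg_comp _ (log_factor z) ca).
  apply: differentiable_continuous; apply/derivable1_diffP.
  by case: (is_derive_log_factor z0 (t := 1 / 2) _).
have : expR (- S l - Afun z / 2 * ((j_ l)%:R / l.*2%:R) +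
   (log_factor z (1 / 2) - log_factor z (1 / 2 - (j_ l)%:R / l.*2%:R))) @[l --> \oo] -->
   expR (- (Bfun z / 12 * X)).
  apply: cvg_expR_comp.
  rewrite -[X in _ --> X]addr0 -[X in _ + X](subrr (log_factor z (1 / 2))).
  apply: cvgD; last by apply: cvgB => //; exact: cvg_cst.
  rewrite -[X in _ --> X]subr0 -[X in _ - X](mulr0 (Afun z / 2)).
  by apply: cvgB; [exact: cvgN|apply: cvgM => //; exact: cvg_cst].
apply: cvg_trans; apply: near_eq_cvg; near=> l.
rewrite tilted_ratioE//.
have nR : 0 < l.*2%:R :> R by near: l.
have : (j_ l)%:R / l.*2%:R <= 4^-1 :> R by near: l; exact: jsmall.
rewrite ler_pdivrMr// -mul2n natrM => ?.
have : 0 < l%:R :> R by move: nR; rewrite -mul2n natrM; lra.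
by move=> ?; rewrite -(ltr_nat R); lra.
Unshelve. all: by end_near. Qed.

End CentralRatio.

(** * Riemann sums by dominated convergence *)

Section RiemannDominated.
Variable R : realType.
Local Notation mu := (@lebesgue_measure R).
Implicit Types (x c : R).

(** The normal density of variance 1/(2c), up to its normalization. *)
Lemma gauss_integral_scaled c : 0 < c ->
  mu.-integrable setT (EFin \o (fun x => expR (- (c * x ^+ 2)))) /\
  \int[mu]_x expR (- (c * x ^+ 2)) = Num.sqrt (pi / c).
Proof.
move=> c0; pose s : R := Num.sqrt (2 * c)^-1.
have s2 : s ^+ 2 = (2 * c)^-1 by rewrite sqr_sqrtr// invr_ge0 mulr_ge0// ltW.
have s0 : s != 0 by rewrite gt_eqF// sqrtr_gt0 invr_gt0 mulr_gt0.
have pk : normal_peak s = (Num.sqrt (pi / c))^-1.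
  rewrite /normal_peak s2; congr (Num.sqrt _)^-1.
  by rewrite -mulr_natr; move: (@pi R) => P; field; rewrite gt_eqF.
have pk0 : Num.sqrt (pi / c) != 0 by rewrite gt_eqF// sqrtr_gt0 divr_gt0// pi_gt0.
have E : (fun x => expR (- (c * x ^+ 2))) =
         (fun x => Num.sqrt (pi / c) * normal_pdf 0 s x).
  apply/funext => x; rewrite normal_pdfE//= pk mulVKf// /normal_fun subr0 s2.
  by congr expR; rewrite -mulr_natr; field; rewrite gt_eqF.
have I := integrable_normal_pdf (0 : R) s.
split; rewrite E.
  exact: (integrableZl measurableT (Num.sqrt (pi / c)) I).
rewrite RintegralZl//.
by rewrite /Rintegral integral_normal_pdf/= mulr1.
Qed.

Section StepFunction.
Variables (N : R) (a : int -> R) (l : nat).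
Hypothesis N0 : 0 < N.

Let cell (k : nat) : set R :=
  `[(k%:Z - l%:Z)%:~R / N, (k%:Z - l%:Z + 1)%:~R / N[%classic.

(** The step function whose integral is the Riemann sum of [a] at the points k/N:
    it takes the value a(k-l) on the cell of length 1/N starting at (k-l)/N. *)
Definition stepfun x : R :=
  \sum_(0 <= k < l.*2.+1) a (k%:Z - l%:Z) * \1_(cell k) x.

Let cellE k x : \1_(cell k) x = (Num.floor (x * N) == k%:Z - l%:Z)%:R :> R.
Proof.
rewrite indicE; congr (_%:R); congr nat_of_bool.
rewrite /cell mem_setE in_itv/= ler_pdivrMr// ltr_pdivlMr//.
apply/idP/eqP => [h|<-]; first exact: floor_def.
exact: floor_itv.
Qed.

Lemma stepfunE x : stepfun x =
  if (`|Num.floor (x * N)| <= l)%N then a (Num.floor (x * N)) else 0.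
Proof.
rewrite /stepfun; under eq_bigr do rewrite cellE.
set f := Num.floor _; case: ifPn => fl.
  pose k0 := absz (f + l%:Z).
  have fE : f = k0%:Z - l%:Z by rewrite /k0; lia.
  rewrite [RHS](_ : _ = a (k0%:Z - l%:Z)) -?fE//.
  transitivity (\sum_(0 <= k < l.*2.+1 | k == k0) a (k%:Z - l%:Z)).
    rewrite [RHS]big_mkcond/=; apply: eq_bigr => k _.
    have -> : (f == k%:Z - l%:Z) = (k == k0) by apply/eqP/eqP; lia.
    by case: eqP => _; rewrite ?mulr1 ?mulr0.
  rewrite big_nat1_eq ifT ?fE//.
  by move: fl; rewrite fE; lia.
rewrite big_nat big1// => k /andP[_ kl].
by rewrite (_ : (f == _) = false) ?mulr0//; apply/eqP; lia.
Qed.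

Let measurable_cell k : measurable (cell k).
Proof. exact: measurable_itv. Qed.

Lemma measurable_stepfun : measurable_fun setT stepfun.
Proof.
by apply: measurable_sum => k; apply: measurable_funM.
Qed.

Lemma integral_stepfun : (\int[mu]_x (stepfun x)%:E)%E =
  ((\sum_(0 <= k < l.*2.+1) a (k%:Z - l%:Z)) / N)%:E.
Proof.
rewrite /stepfun; under eq_integral do rewrite -sumEFin.
have I k : mu.-integrable setT (fun x => (a (k%:Z - l%:Z) * \1_(cell k) x)%:E).
  under eq_fun do rewrite EFinM; apply: integrableZl => //.
  exact: integrable_indic_itv.
rewrite integral_sum// mulr_suml -sumEFin; apply: eq_bigr => k _.
under eq_integral do rewrite EFinM.
rewrite integralZl//; last exact: integrable_indic_itv.
rewrite integral_indic//; last exact: measurable_cell.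
rewrite setIT /cell /= lebesgue_measure_itv/= lte_fin.
rewrite ltr_pM2r ?invr_gt0// ltr_int ltrDl ltr01 -EFinB -EFinM; congr (_ * _)%:E.
by rewrite intrD; field; rewrite gt_eqF.
Qed.

End StepFunction.

(** Dominated convergence for the step functions with value
    a_l(floor(x N_l)) at x.  A Gaussian bound in floor(x N_l)/N_l yields one in x,
    because the two differ by at most 1/N_l <= 1. *)
Lemma cvg_riemann_dominated (N : nat -> R) (a : nat -> int -> R) (f : R -> R) (K c : R) :
  0 < c ->
  (forall l, (0 < l)%N -> 1 <= N l) ->
  measurable_fun setT f ->
  (forall l j, (0 < l)%N -> (`|j| <= l)%N ->
     `|a l j| <= K * expR (- (c * (j%:~R / N l) ^+ 2))) ->
  (forall x, \forall l \near \oo, (`|Num.floor (x * N l)| <= l)%N) ->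
  (forall x, a l (Num.floor (x * N l)) @[l --> \oo] --> f x) ->
  mu.-integrable setT (EFin \o f) /\
  (\sum_(0 <= k < l.*2.+1) a l (k%:Z - l%:Z)) / N l @[l --> \oo] -->
    \int[mu]_x f x.
Proof.
move=> c0 N1 mf dom supp pt.
have N0 l : (0 < l)%N -> 0 < N l by move=> /N1; apply: lt_le_trans.
(* index shifted, since N 0 may vanish *)
pose g l := stepfun (N l.+1) (a l.+1) l.+1.
pose h x := `|K| * (expR c * expR (- (c / 2 * x ^+ 2))).
have [] := @dominated_convergence _ _ R mu setT measurableT
  (fun l => EFin \o g l) (EFin \o f) (EFin \o h).
- by move=> l; apply/measurable_EFinP; exact: measurable_stepfun.
- exact/measurable_EFinP.
- apply: aeW => x _; apply: cvg_EFin; first by near=> l.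
  have ptS : a l.+1 (Num.floor (x * N l.+1)) @[l --> \oo] --> f x.
    by have := pt x; rewrite -cvg_shiftS.
  apply: cvg_trans ptS; apply: near_eq_cvg.
  have [M _ HM] := supp x.
  exists M => // l /= Ml; rewrite /g stepfunE ?N0//= ifT//.
  by apply: HM; rewrite /= (leq_trans Ml).
- have c20 : 0 < c / 2 by rewrite divr_gt0.
  exact: (integrableZl measurableT `|K| (integrableZl measurableT (expR c)
    (gauss_integral_scaled c20).1)).
- apply: aeW => x l _; rewrite /= lee_fin /g stepfunE ?N0//.
  case: ifPn => jl; last by rewrite normr0 !mulr_ge0 ?expR_ge0.
  rewrite (le_trans (dom _ _ _ _))// /h.
  have NS := N1 l.+1 isT; have N00 := N0 l.+1 isT.
  set t := _%:~R / _.
  have /andP[tx xt] : t <= x < t + 1.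
    rewrite /t ler_pdivrMr// floor_le/=.
    rewrite -(ltr_pM2r N00) mulrDl divfK ?gt_eqF// mul1r.
    by rewrite (lt_le_trans (floorD1_gt _))// intrD lerD2l.
  apply: (@le_trans _ _ (`|K| * expR (- (c * t ^+ 2)))).
    by rewrite ler_wpM2r ?expR_ge0// ler_norm.
  rewrite ler_wpM2l// -expRD ler_expR.
  (* x^2 <= 2 t^2 + 2, since 0 <= x - t < 1 *)
  have : 0 <= (t - (x - t)) ^+ 2 by exact: sqr_ge0.
  have : 0 <= (1 - (x - t)) * (1 + (x - t)) by rewrite mulr_ge0//; lra.
  move=> h1 h2; have : 0 <= 1 - x ^+ 2 / 2 + t ^+ 2 by lra.
  by move=> /(mulr_ge0 (ltW c0)); lra.
move=> I _ C; split => //.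
rewrite -cvg_shiftS.
have fin : (\int[mu]_x (f x)%:E)%E = (\int[mu]_x f x)%:E.
  by rewrite /Rintegral fineK//; exact: integrable_fin_num.
have {}C : (\int[mu]_x (g l x)%:E)%E @[l --> \oo] --> (\int[mu]_x f x)%:E.
  by rewrite -fin.
have /(_ _) {}C := fine_cvg C; apply: cvg_trans C; apply: near_eq_cvg.
by apply: nearW => l; rewrite /= /g integral_stepfun ?N0.
Unshelve. all: by end_near. Qed.

End RiemannDominated.

(** * Laplace sums of tilted ratios at an abstract scale *)

Section WeightedSums.
Variables (R : realType) (z : R).
Hypothesis z0 : 0 < z.
Local Notation mu := (@lebesgue_measure R).

Lemma cvg_floor_scaled (N : nat -> R) (x : R) :
  (forall l, (0 < l)%N -> 0 < N l) -> (N l)^-1 @[l --> \oo] --> (0 : R) ->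
  (Num.floor (x * N l))%:~R / N l @[l --> \oo] --> x.
Proof.
move=> N0 NV; apply: (@squeeze_cvgr _ _ _ _ (fun l => x - (N l)^-1) (fun=> x)).
- near=> l; have Nl : 0 < N l by apply: N0; near: l; exact: nbhs_infty_gt.
  rewrite ler_pdivrMr// floor_le andbT ler_pdivlMr// mulrBl mulVf ?gt_eqF//.
  by have := floorD1_gt (x * N l); rewrite intrD; lra.
- by rewrite -[X in _ --> X]subr0; apply: cvgB => //; exact: cvg_cst.
- exact: cvg_cst.
Unshelve. all: by end_near. Qed.

(** At the scale N the quartic exponent j^4/n^3 is (j/N)^4 N^4/n^3, so [lam]
    decides whether the quartic term survives in the limit.  The factor G is the
    Gaussian weight that comes on top of the tilted ratios.  It is used with
    N = n^(3/4), lam = 1, and with N = n^(1/2), lam = 0. *)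
Lemma cvg_tilted_sum (N : nat -> R) (m : nat) (G : R -> R) (lam K c : R) :
  0 < c -> continuous G ->
  (forall l, (0 < l)%N -> 1 <= N l) ->
  (N l)^-1 @[l --> \oo] --> (0 : R) ->
  N l / l.*2%:R @[l --> \oo] --> (0 : R) ->
  N l ^+ 4 / l.*2%:R ^+ 3 @[l --> \oo] --> lam ->
  (forall l (t : R), (0 < l)%N ->
     `|t| ^+ m * expR (- (defect_const z / 16 * (N l ^+ 4 / l.*2%:R ^+ 3) * t ^+ 4)) *
        expR (G t) <= K * expR (- (c * t ^+ 2))) ->
  let f x := x ^+ m * (expR (- (Bfun z / 12 * (lam * x ^+ 4))) * expR (G x)) in
  mu.-integrable setT (EFin \o f) /\
  (\sum_(0 <= k < l.*2.+1)
     (((k%:Z - l%:Z)%:~R / N l) ^+ m *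
      (tilted_ratio z l `|k%:Z - l%:Z|%N * expR (G ((k%:Z - l%:Z)%:~R / N l)))))
    / N l @[l --> \oo] --> \int[mu]_x f x.
Proof.
move=> c0 cG N1 NV Nn N4 dom f.
have N0 l : (0 < l)%N -> 0 < N l by move=> /N1; apply: lt_le_trans.
pose a l (j : int) : R := (j%:~R / N l) ^+ m *
   (tilted_ratio z l `|j|%N * expR (G (j%:~R / N l))).
have absE l (j : int) : (0 < l)%N -> `|j|%N%:R = `|j%:~R / N l| * N l :> R.
  move=> l0; rewrite normrM normfV (gtr0_norm (N0 l l0)) divfK ?gt_eqF ?N0//.
  by rewrite -intr_norm -natr_absz.
have small x : (`|Num.floor (x * N l)|%N)%:R / l.*2%:R @[l --> \oo] --> (0 : R).
  have : `|(Num.floor (x * N l))%:~R / N l| * (N l / l.*2%:R) @[l --> \oo]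
       --> `|x| * 0.
    by apply: cvgM => //; apply: cvg_norm; exact: cvg_floor_scaled.
  rewrite mulr0; apply: cvg_trans; apply: near_eq_cvg; near=> l.
  by rewrite (absE l) ?mulrA//; near: l; exact: nbhs_infty_gt.
apply: (@cvg_riemann_dominated _ N a f (expR (Afun z / 4 + defect_const z) * K) c) => //.
- apply: continuous_measurable_fun => x; apply: cvgM.
    by apply: cvgrX; exact: cvg_id.
  apply: cvgM; apply: cvg_expR_comp; last exact: cG.
  apply: cvgN; apply: cvgM; first exact: cvg_cst.
  by apply: cvgM; [exact: cvg_cst|apply: cvgrX; exact: cvg_id].
- move=> l j l0 jl; have Nl := N0 l l0.
  rewrite /a normrM normrX [`|tilted_ratio _ _ _ * _|]normrM (ger0_norm (expR_ge0 _)).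
  have r0 : 0 <= tilted_ratio z l `|j|.
    have r01 : 0 <= expR (- z / l.*2%:R : R) < 1.
      by rewrite expR_ge0 expR_lt1 mulNr oppr_lt0 divr_gt0// ltr0n double_gt0.
    by rewrite mulr_ge0 ?expR_ge0// divr_ge0//; apply/ltW/gbinom_gt0.
  rewrite (ger0_norm r0); set t := _ / N l.
  have := tilted_ratio_le z0 jl l0; rewrite (absE l)// -/t exprMn.
  have -> : defect_const z / 16 * (`|t| ^+ 4 * N l ^+ 4 / l.*2%:R ^+ 3) =
     defect_const z / 16 * (N l ^+ 4 / l.*2%:R ^+ 3) * t ^+ 4.
    by rewrite -normrX ger0_norm ?exprn_even_ge0//; ring.
  move=> rl; rewrite -mulrA.
  apply: le_trans (ler_wpM2l (expR_ge0 _) (dom l t l0)).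
  rewrite [leRHS]mulrA [X in _ <= X * _]mulrCA -[leRHS]mulrA.
  by rewrite ler_wpM2l ?exprn_ge0// ler_wpM2r ?expR_ge0.
- move=> x.
  have h : 0 < 2^-1 :> R by [].
  have := small x => /cvgrPdist_le/(_ _ h); near_simpl => hl.
  near=> l; have nR : 0 < l.*2%:R :> R.
    by rewrite ltr0n double_gt0; near: l; exact: nbhs_infty_gt.
  have : `|0 - (`|Num.floor (x * N l)|%N)%:R / l.*2%:R| <= 2^-1 :> R by near: l.
  rewrite sub0r normrN ger0_norm ?divr_ge0// ler_pdivrMr// -mul2n natrM mulKf//.
  by rewrite ler_nat.
- move=> x; rewrite /a /f.
  have cx := cvg_floor_scaled (x := x) N0 NV.
  apply: cvgM; first exact: cvgrX.
  apply: cvgM; last first.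
    by apply: cvg_expR_comp; apply: (cvg_comp _ G cx); exact: cG.
  apply: (@cvg_tilted_ratio _ z z0 (fun l => `|Num.floor (x * N l)|%N) (lam * x ^+ 4)).
    exact: small.
  have : (N l ^+ 4 / l.*2%:R ^+ 3) * ((Num.floor (x * N l))%:~R / N l) ^+ 4
     @[l --> \oo] --> lam * x ^+ 4.
    by apply: cvgM => //; exact: cvgrX.
  apply: cvg_trans; apply: near_eq_cvg; near=> l.
  have l0 : (0 < l)%N by near: l; exact: nbhs_infty_gt.
  rewrite (absE l)// [in RHS]exprMn -normrX ger0_norm ?exprn_even_ge0//; ring.
Unshelve. all: by end_near. Qed.

End WeightedSums.

(** * Reduction of the (p,q)-binomials to tilted ratios *)

Section CentralAsymptotics.
Variables (R : realType) (z : R).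
Hypothesis z0 : 0 < z.
Local Notation mu := (@lebesgue_measure R).
Implicit Types (l k : nat) (gamma : R).

(** The fourth root of n = 2l: the scales n^(1/2) and n^(3/4) are integer powers
    of it, so that identities between them are rational. *)
Definition root4 l : R := Num.sqrt (Num.sqrt l.*2%:R).

Lemma root4_ge1 l : (0 < l)%N -> 1 <= root4 l.
Proof.
move=> l0; have h : 1 <= l.*2%:R :> R by rewrite ler1n double_gt0.
by rewrite /root4 -[leLHS]sqrtr1 ler_wsqrtr// -[leLHS]sqrtr1 ler_wsqrtr.
Qed.

Lemma root4_sqr l : root4 l ^+ 2 = Num.sqrt l.*2%:R.
Proof. by rewrite sqr_sqrtr// sqrtr_ge0. Qed.

Lemma root4X4 l : root4 l ^+ 4 = l.*2%:R.
Proof. by rewrite -[4%N]/(2 * 2)%N exprM root4_sqr sqr_sqrtr. Qed.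

Lemma root4_powR l m : root4 l ^+ m = l.*2%:R `^ (m%:R / 4).
Proof.
have -> : m%:R / 4 = 2^-1 * (2^-1 * m%:R) :> R by field.
rewrite powRrM powR12_sqrt// powRrM powR12_sqrt ?sqrtr_ge0//.
by rewrite powR_mulrn// sqrtr_ge0.
Qed.

Lemma cvg_root4V : (root4 l)^-1 @[l --> \oo] --> (0 : R).
Proof.
have vn : l.*2%:R^-1 @[l --> \oo] --> (0 : R).
  apply/gtr0_cvgV0.
    by near=> l; rewrite ltr0n double_gt0; near: l; exact: nbhs_infty_gt.
  apply/cvgryPge => A; near=> l.
  rewrite (@le_trans _ _ l%:R)//; last by rewrite ler_nat -addnn leq_addr.
  by near: l; exact: nbhs_infty_ger.
have E l : (root4 l)^-1 = Num.sqrt (Num.sqrt (l.*2%:R^-1)).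
  by rewrite /root4 !sqrtrV ?sqrtr_ge0.
have sq0 (f : nat -> R) : f @ \oo --> (0 : R) ->
    Num.sqrt (f l) @[l --> \oo] --> (0 : R).
  move=> f0; rewrite -[X in _ --> X](@sqrtr0 R).
  by apply: (cvg_comp _ (@Num.sqrt R) f0); exact: sqrt_continuous.
by rewrite (funext E); exact/sq0/sq0.
Unshelve. all: by end_near. Qed.

Lemma gbinom_central_ratio l k : (k <= l.*2)%N ->
  gbinom (r_ z l.*2) l.*2 k =
  gbinom (r_ z l.*2) l.*2 l * central_ratio z l `|k%:Z - l%:Z|%N.
Proof.
case: l => [|l].
  rewrite leqn0 => /eqP->; rewrite /central_ratio /= addn0 divff ?mulr1//.
  by rewrite /gbinom qfact0 !mul1r invr_eq0 oner_neq0.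
set L := l.+1 => kl; have L0 : (0 < L)%N by [].
have nR : 0 < L.*2%:R :> R by rewrite ltr0n double_gt0.
have r01 : 0 <= r_ z L.*2 < 1.
  by rewrite expR_ge0 expR_lt1 mulNr oppr_lt0 divr_gt0.
rewrite /central_ratio mulrC divfK ?gt_eqF ?gbinom_gt0//.
have [Lk|kL] := leqP L k; first by congr gbinom; lia.
rewrite -(gbinom_sym _ kl); congr gbinom; lia.
Qed.

Lemma C_gbinom gamma l k : (0 < l)%N -> (k <= l.*2)%N ->
  C_ z gamma l.*2 k =
  expR (- (u_ z gamma l.*2 / l.*2%:R * (k * (l.*2 - k))%:R)) *
  gbinom (r_ z l.*2) l.*2 k.
Proof.
move=> l0 kl; have nR : 0 < l.*2%:R :> R by rewrite ltr0n double_gt0.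
rewrite /C_ /pqbinom /q_ pqbinom_gbinom//.
- by rewrite /p_ -expRM_natl; congr (expR _ * _); ring.
- by rewrite gt_eqF// expR_gt0.
- by move=> j j0; rewrite lt_eqF// expRX_lt1// mulNr oppr_lt0 divr_gt0.
Qed.

Lemma C_center gamma l : (0 < l)%N ->
  C_ z gamma l.*2 l =
  expR (- (u_ z gamma l.*2 * l.*2%:R / 4)) * gbinom (r_ z l.*2) l.*2 l.
Proof.
move=> l0; rewrite C_gbinom// -?addnn ?leq_addr// addKn addnn.
have lR : 0 < l%:R :> R by rewrite ltr0n.
congr (expR _ * _); rewrite -mul2n !natrM.
by field; rewrite gt_eqF.
Qed.

(** With j = k - l, k(n-k) = l^2 - j^2 and u/n = A/(2n) + gamma/n^(3/2): the first
    part of u supplies the tilt of the Gaussian binomial ratio, the second the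
    factor exp(gamma (j/n^(3/4))^2). *)
Lemma C_split gamma l k : (0 < l)%N -> (k <= l.*2)%N ->
  C_ z gamma l.*2 k = C_ z gamma l.*2 l *
   (tilted_ratio z l `|k%:Z - l%:Z|%N *
    expR (gamma * ((k%:Z - l%:Z)%:~R / root4 l ^+ 3) ^+ 2)).
Proof.
move=> l0 kl; rewrite C_center// C_gbinom// gbinom_central_ratio// /tilted_ratio.
set d := `|k%:Z - l%:Z|%N.
have M0 : 0 < root4 l by rewrite (lt_le_trans _ (root4_ge1 l0)).
have -> : ((k%:Z - l%:Z)%:~R : R) = k%:R - l%:R by rewrite intrB.
have dE : (d%:R : R) ^+ 2 = (k%:R - l%:R) ^+ 2.
  by rewrite /d natr_absz intr_norm real_normK ?num_real// intrB.
have kE : (k * (l.*2 - k))%:R = l%:R ^+ 2 - (k%:R - l%:R) ^+ 2 :> R.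
  by rewrite natrM natrB// -mul2n natrM; ring.
rewrite dE kE.
have lE : l%:R = root4 l ^+ 4 / 2.
  by rewrite root4X4 -mul2n natrM mulrC mulKf.
transitivity (gbinom (r_ z l.*2) l.*2 l * central_ratio z l d *
  expR (- (u_ z gamma l.*2 * l.*2%:R / 4) +
   Afun z / 2 * ((k%:R - l%:R) ^+ 2 / l.*2%:R) +
   gamma * ((k%:R - l%:R) / root4 l ^+ 3) ^+ 2)); last by rewrite !expRD; ring.
rewrite mulrC; congr (_ * expR _); rewrite /u_ -root4_sqr -root4X4.
rewrite lE; move: (root4 l) M0 => M M0.
by field; rewrite gt_eqF.
Qed.

Lemma exprn_le_fact_expR (m : nat) (t : R) : `|t| ^+ m <= m`!%:R * expR (1 + t ^+ 2).
Proof.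
apply: (@le_trans _ _ (m`!%:R * expR `|t|)).
  rewrite -ler_pdivrMl ?ltr0n ?fact_gt0// mulrC.
  case: m => [|m].
    by rewrite fact0 divr1 expr0 -expR0 ler_expR.
  by rewrite (le_trans _ (expR_ge1Dxn m (normr_ge0 t)))// lerDr.
rewrite ler_wpM2l// ler_expR -(@real_normK R t) ?num_real//.
have := sqr_ge0 (`|t| - 1 / 2); have := normr_ge0 t.
by move: `|t| => s; rewrite !expr2; lra.
Qed.

(** A power of t is bounded by a multiple of exp(1 + t^2), and the quartic term
    absorbs the remaining quadratic exponent by completing the square. *)
Lemma quartic_domination (m : nat) (b gamma t : R) : 0 < b ->
  `|t| ^+ m * expR (- (b * t ^+ 4)) * expR (gamma * t ^+ 2) <=
  m`!%:R * expR (1 + (gamma + 2) ^+ 2 / (4 * b)) * expR (- (1 * t ^+ 2)).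
Proof.
move=> b0.
apply: (@le_trans _ _ (m`!%:R * expR (1 + t ^+ 2) *
   expR (- (b * t ^+ 4)) * expR (gamma * t ^+ 2))).
  by rewrite ler_wpM2r ?expR_ge0// ler_wpM2r ?expR_ge0// exprn_le_fact_expR.
rewrite -!mulrA -!expRD ler_wpM2l// ler_expR.
have -> : t ^+ 4 = (t ^+ 2) ^+ 2 by rewrite -exprM.
have : 0 <= (2 * b * t ^+ 2 - (gamma + 2)) ^+ 2 / (4 * b).
  by rewrite divr_ge0 ?sqr_ge0// mulr_ge0// ltW.
have -> : (2 * b * t ^+ 2 - (gamma + 2)) ^+ 2 / (4 * b) =
  b * t ^+ 2 ^+ 2 - (gamma + 2) * t ^+ 2 + (gamma + 2) ^+ 2 / (4 * b).
  by field; rewrite gt_eqF.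
by lra.
Qed.

Let cont_sqr c : continuous (fun x : R => c * x ^+ 2).
Proof.
by move=> x; apply: cvgM; [exact: cvg_cst|apply: cvgrX; exact: cvg_id].
Qed.

Lemma cvg_moments m gamma :
  mu.-integrable setT (EFin \o
    (fun x : R => x ^+ m * expR (gamma * x ^+ 2 - Bfun z / 12 * x ^+ 4))) /\
  (\sum_(0 <= k < l.*2.+1)
     (((k%:Z - l%:Z)%:~R / root4 l ^+ 3) ^+ m *
      (tilted_ratio z l `|k%:Z - l%:Z|%N *
       expR (gamma * ((k%:Z - l%:Z)%:~R / root4 l ^+ 3) ^+ 2))))
    / root4 l ^+ 3 @[l --> \oo] --> mu_ m z gamma.
Proof.
have M0 l : (0 < l)%N -> 0 < root4 l.
  by move=> /root4_ge1; exact: lt_le_trans.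
have N4 l : (0 < l)%N -> (root4 l ^+ 3) ^+ 4 / l.*2%:R ^+ 3 = 1.
  move=> l0; rewrite -root4X4 -!exprM divff// expf_neq0// gt_eqF//.
  exact: M0.
have := @cvg_tilted_sum R z z0 (fun l => root4 l ^+ 3) m (fun x => gamma * x ^+ 2)
   1 (m`!%:R * expR (1 + (gamma + 2) ^+ 2 / (4 * (defect_const z / 16)))) 1 ltr01
   (@cont_sqr gamma).
have -> : (fun x : R => x ^+ m * (expR (- (Bfun z / 12 * (1 * x ^+ 4))) *
      expR (gamma * x ^+ 2))) =
   (fun x : R => x ^+ m * expR (gamma * x ^+ 2 - Bfun z / 12 * x ^+ 4)).
  by apply/funext => x; rewrite -expRD mul1r [- _ + _]addrC.
apply.
- by move=> l l0; rewrite exprn_ege1// root4_ge1.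
- have h : (root4 l)^-1 ^+ 3 @[l --> \oo] --> (0 ^+ 3 : R).
    by apply: cvgrX; exact: cvg_root4V.
  rewrite expr0n/= in h; apply: cvg_trans h; apply: near_eq_cvg.
  by apply: nearW => l; rewrite exprVn.
- apply: cvg_trans cvg_root4V; apply: near_eq_cvg; near=> l.
  have := M0 l; rewrite -root4X4 => Ml; field; rewrite gt_eqF// Ml//.
  by near: l; exact: nbhs_infty_gt.
- have h : (fun _ : nat => 1 : R) @ \oo --> (1 : R) by exact: cvg_cst.
  apply: cvg_trans h; apply: near_eq_cvg; near=> l.
  by rewrite N4//; near: l; exact: nbhs_infty_gt.
- move=> l t l0; rewrite N4// mulr1; apply: quartic_domination.
  by rewrite divr_gt0// defect_const_gt0.
Unshelve. all: by end_near. Qed.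

End CentralAsymptotics.

(** * The central Gaussian binomial *)

Section Normalization.
Variables (R : realType) (z : R).
Hypothesis z0 : 0 < z.
Local Notation mu := (@lebesgue_measure R).
Implicit Types (l k : nat) (gamma : R).

Let w := expR (z / 2).
Let c := (Afun z + z) / 2.

Let c0 : 0 < c.
Proof. by rewrite divr_gt0// addr_gt0// Afun_gt0. Qed.

Lemma dfunE : dfun z = (Num.sqrt (pi / c))^-1.
Proof.
have w1 : 1 < w by rewrite expR_gt1 divr_gt0.
have cE : c = z * (w + 1) / (2 * (w - 1)).
  by rewrite /c AfunE// -/w; field; rewrite gt_eqF// subr_gt0.
have -> : (Num.sqrt (pi / c))^-1 = Num.sqrt (c / pi).
  by rewrite -invf_div sqrtrV ?invrK// divr_ge0// ?pi_ge0// ltW.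
have ge0 x : 0 <= x -> 0 <= 1 - expR (- x) :> R.
  by move=> x0; rewrite subr_ge0 expR_le1 oppr_le0.
rewrite /dfun mul1r powR12_sqrt; last first.
  apply: divr_ge0; first by rewrite mulr_ge0 ?ge0// ltW.
  by rewrite mulr_ge0 ?sqr_ge0// mulr_ge0// pi_ge0.
congr Num.sqrt; rewrite cE mulNr.
have -> : expR (- z) = w ^- 2.
  by rewrite -expRM_natl -expRN; congr expR; field.
rewrite expRN -/w; move: w w1 (@pi R) (pi_gt0 R) => W W1 P P0.
have h1 : W - 1 != 0 by rewrite gt_eqF// subr_gt0.
have h2 : W != 0 by rewrite gt_eqF//; lra.
by field; rewrite h1 h2 gt_eqF.
Qed.

(** By [gbinom_theta] the sum of the Gaussian binomials weighted by r^(j^2/2) is a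
    product asymptotic to exp(n H(z)).  It is also the central term times the sum
    of the tilted ratios weighted by exp(-c j^2/n), where c = (A+z)/2, and this
    last sum is asymptotic to sqrt n sqrt(pi/c) = sqrt n / d(z). *)
Lemma cvg_central_gbinom :
  gbinom (r_ z l.*2) l.*2 l * root4 R l ^+ 2 / expR (l.*2%:R * Hfun z)
    @[l --> \oo] --> dfun z.
Proof.
have M0 l : (0 < l)%N -> 0 < root4 R l.
  by move=> /(root4_ge1 R); exact: lt_le_trans.
pose G (x : R) := - (c * x ^+ 2).
pose T l := (\sum_(0 <= k < l.*2.+1)
   (((k%:Z - l%:Z)%:~R / root4 R l ^+ 2) ^+ 0 *
    (tilted_ratio z l `|k%:Z - l%:Z|%N * expR (G ((k%:Z - l%:Z)%:~R / root4 R l ^+ 2))))) /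
   root4 R l ^+ 2.
have vX m : (root4 R l)^-1 ^+ m.+1 @[l --> \oo] --> (0 : R).
  have h : (root4 R l)^-1 ^+ m.+1 @[l --> \oo] --> (0 ^+ m.+1 : R).
    by apply: cvgrX; exact: cvg_root4V.
  by rewrite expr0n/= in h.
have cT : T l @[l --> \oo] --> Num.sqrt (pi / c).
  have := @cvg_tilted_sum R z z0 (fun l => root4 R l ^+ 2) 0 G 0 1 c c0.
  have -> : (fun x : R => x ^+ 0 * (expR (- (Bfun z / 12 * (0 * x ^+ 4))) *
     expR (G x))) = (fun x => expR (- (c * x ^+ 2))).
    by apply/funext => x; rewrite expr0 mul1r mul0r mulr0 oppr0 expR0 mul1r.
  cbv zeta; rewrite (gauss_integral_scaled c0).2; case => //.
  - move=> x; apply: cvgN; apply: cvgM; first exact: cvg_cst.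
    by apply: cvgrX; exact: cvg_id.
  - by move=> l l0; rewrite exprn_ege1// root4_ge1.
  - apply: cvg_trans (vX 1%N); apply: near_eq_cvg.
    by apply: nearW => l; rewrite exprVn.
  - apply: cvg_trans (vX 1%N); apply: near_eq_cvg; near=> l.
    have := M0 l; rewrite -root4X4 => Ml; field; rewrite gt_eqF// Ml//.
    by near: l; exact: nbhs_infty_gt.
  - apply: cvg_trans (vX 3%N); apply: near_eq_cvg; near=> l.
    have := M0 l; rewrite -root4X4 => Ml; field; rewrite gt_eqF// Ml//.
    by near: l; exact: nbhs_infty_gt.
  - move=> l t l0; rewrite expr0 !mul1r -[leRHS]mul1r ler_wpM2r ?expR_ge0//.
    rewrite expR_le1 oppr_le0 mulr_ge0 ?exprn_even_ge0// mulr_ge0//.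
      by rewrite divr_ge0// ltW// defect_const_gt0.
    by rewrite divr_ge0 ?exprn_ge0// ltW// M0.
have P l : (0 < l)%N ->
    \prod_(1 <= i < l.+1) (1 + expR (- z / l.*2%:R / 2) ^+ i.*2.-1) ^+ 2 =
    gbinom (r_ z l.*2) l.*2 l * root4 R l ^+ 2 * T l.
  move=> l0; have nR : 0 < l.*2%:R :> R by rewrite ltr0n double_gt0.
  set s := expR _.
  have rs : r_ z l.*2 = s ^+ 2 by rewrite -expRM_natl; congr expR; field; rewrite gt_eqF.
  rewrite -gbinom_theta; last 2 first.
  - by rewrite gt_eqF// expR_gt0.
  - move=> j j0; rewrite lt_eqF// expRX_lt1// !mulNr oppr_lt0 !divr_gt0//.
  have Ml := M0 l l0.
  rewrite /T -mulrA [root4 R l ^+ 2 * _]mulrC divfK ?expf_neq0 ?gt_eqF//.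
  rewrite mulr_sumr !big_nat; apply: eq_bigr => k /andP[_ kl].
  rewrite -rs gbinom_central_ratio// -mulrA; congr (_ * _).
  rewrite expr0 mul1r /tilted_ratio -mulrA; congr (_ * _).
  rewrite -expRD /s -expRM_natl; congr expR; rewrite /G /c.
  have -> : ((`|k%:Z - l%:Z| ^ 2)%N%:R : R) = (k%:R - l%:R) ^+ 2.
    by rewrite natrX natr_absz intr_norm real_normK ?num_real// intrB.
  have -> : (`|k%:Z - l%:Z|%N%:R : R) ^+ 2 = (k%:R - l%:R) ^+ 2.
    by rewrite natr_absz intr_norm real_normK ?num_real// intrB.
  rewrite intrB -root4X4; move: (root4 R l) Ml => M Ml.
  by field; rewrite gt_eqF.
have s0 : Num.sqrt (pi / c) != 0.
  by rewrite gt_eqF// sqrtr_gt0 divr_gt0// pi_gt0.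
have h : (\prod_(1 <= i < l.+1) (1 + expR (- z / l.*2%:R / 2) ^+ i.*2.-1) ^+ 2 /
    expR (l.*2%:R * Hfun z)) / T l @[l --> \oo] --> 1 / Num.sqrt (pi / c).
  by apply: cvgM; [exact: cvg_theta_product|exact: cvgV].
rewrite div1r -dfunE in h.
have sp : 0 < `|Num.sqrt (pi / c)| by rewrite normr_gt0.
have nT := (cvgrPdist_lt _ _).1 cT _ sp.
apply: cvg_trans h; apply: near_eq_cvg; near=> l.
have l0 : (0 < l)%N by near: l; exact: nbhs_infty_gt.
have T0 : T l != 0.
  have : `|Num.sqrt (pi / c) - T l| < `|Num.sqrt (pi / c)|.
    by near: l; exact: nT.
  by apply: contraTN => /eqP ->; rewrite subr0 ltxx.
by rewrite P// mulrAC mulfK.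
Unshelve. all: by end_near. Qed.

(** The integrand is bounded below by a positive constant on [0, 1]. *)
Lemma mu0_gt0 gamma : 0 < mu_ 0 z gamma.
Proof.
pose f (x : R) := x ^+ 0 * expR (gamma * x ^+ 2 - Bfun z / 12 * x ^+ 4).
have [I _] := cvg_moments z0 0 gamma.
have mf : measurable_fun setT (EFin \o f) by exact: measurable_int I.
pose e := expR (- `|gamma| - Bfun z / 12).
have e0 : 0 < e by exact: expR_gt0.
have fin : (\int[mu]_x (f x)%:E)%E = (mu_ 0 z gamma)%:E.
  by rewrite /mu_ /Rintegral fineK//; exact: integrable_fin_num.
have f0 x : (0 <= (f x)%:E)%E by rewrite lee_fin /f expr0 mul1r expR_ge0.
rewrite -lte_fin -fin; apply: (@lt_le_trans _ _ (\int[mu]_(x in `[0%R, 1%R]) e%:E)%E).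
  by rewrite integral_cst//= lebesgue_measure_itv/= lte_fin ltr01 oppr0 adde0 mule1 lte_fin.
apply: (@le_trans _ _ (\int[mu]_(x in `[0%R, 1%R]) (f x)%:E)%E).
  apply: ge0_le_integral => //.
  - by move=> x _; rewrite lee_fin ltW.
  - exact: measurable_funS mf.
  - move=> x /=; rewrite in_itv/= => /andP[x0 x1].
    rewrite lee_fin /f expr0 mul1r ler_expR.
    have B0 := Bfun_gt0 z0.
    have x4 : x ^+ 4 <= 1 by rewrite exprn_ile1.
    have x2 : x ^+ 2 <= 1 by rewrite exprn_ile1.
    have x20 : 0 <= x ^+ 2 by exact: sqr_ge0.
    have g1 : 0 <= `|gamma| * (1 - x ^+ 2) by rewrite mulr_ge0// subr_ge0.
    have g2 : 0 <= (gamma + `|gamma|) * x ^+ 2.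
      by rewrite mulr_ge0// -lerBlDl sub0r -normrN ler_norm.
    have g3 : 0 <= Bfun z * (1 - x ^+ 4) by rewrite mulr_ge0 ?subr_ge0// ltW.
    by move: g1 g2 g3; lra.
by apply: ge0_subset_integral => //.
Qed.

End Normalization.

(** * Assembly *)

Section Assembly.
Variables (R : realType).
Implicit Types (f g : nat -> R) (l k m n : nat).

(** Sequences along the even integers are handled through n = 2l. *)
Lemma cvg_even_oo f (L : R) :
  f l.*2 @[l --> \oo] --> L -> f n @[n --> even_oo] --> L.
Proof.
move=> fL A /fL [M _ HM]; exists M.*2 => // n /= Mn en.
rewrite -(even_halfK en); apply: HM => /=.
by rewrite -leq_double even_halfK.
Qed.

Lemma equiv_even_oo f g :
  (forall l, (0 < l)%N -> g l.*2 != 0) ->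
  f l.*2 / g l.*2 @[l --> \oo] --> (1 : R) -> f ~_even_oo g.
Proof.
move=> g0 fg; apply/eqaddoP => e e0.
move/cvgrPdist_le : fg => /(_ _ e0) [M _ HM].
exists M.+1.*2 => // n /= Mn en.
have nE := even_halfK en.
have lM : (M < n./2)%N by rewrite -ltn_double nE (leq_trans _ Mn).
have := HM n./2 (ltnW lM); rewrite /= nE => h.
have gn : g n != 0 by rewrite -nE g0// (leq_trans _ lM).
rewrite -ler_pdivrMr ?normr_gt0// -normf_div.
by rewrite !fctE mulrBl divff// distrC.
Qed.

Variables (z gamma : R).
Hypothesis z0 : 0 < z.

Let M l : R := root4 R l.

Let M0 l : (0 < l)%N -> 0 < M l.
Proof. by move=> /(root4_ge1 R); exact: lt_le_trans. Qed.

Let T m l : R :=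
  (\sum_(0 <= k < l.*2.+1)
     (((k%:Z - l%:Z)%:~R / root4 R l ^+ 3) ^+ m *
      (tilted_ratio z l `|k%:Z - l%:Z|%N *
       expR (gamma * ((k%:Z - l%:Z)%:~R / root4 R l ^+ 3) ^+ 2))))
    / root4 R l ^+ 3.

Let cvgT m : T m l @[l --> \oo] --> mu_ m z gamma.
Proof. by case: (cvg_moments z0 m gamma). Qed.

Lemma C_center_gt0 l : (0 < l)%N -> 0 < C_ z gamma l.*2 l.
Proof.
move=> l0; rewrite C_center// mulr_gt0 ?expR_gt0// gbinom_gt0//.
by rewrite expR_ge0 expR_lt1 mulNr oppr_lt0 divr_gt0// ltr0n double_gt0.
Qed.

Lemma C_sym l k : (0 < l)%N -> (k <= l.*2)%N ->
  C_ z gamma l.*2 (l.*2 - k) = C_ z gamma l.*2 k.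
Proof.
by move=> l0 kl; rewrite !C_gbinom ?leq_subr// subKn// mulnC gbinom_sym.
Qed.

Lemma sum_moment m l : (0 < l)%N ->
  \sum_(0 <= k < l.*2.+1)
    ((k%:R - (kappa l.*2)%:R) / l.*2%:R `^ (3 / 4)) ^+ m * C_ z gamma l.*2 k =
  C_ z gamma l.*2 l * M l ^+ 3 * T m l.
Proof.
move=> l0; rewrite /kappa doubleK -root4_powR /T /M.
have M3 : M l ^+ 3 != 0 by rewrite expf_neq0// gt_eqF// M0.
rewrite -[RHS]mulrA [root4 R l ^+ 3 * _]mulrC divfK//.
rewrite mulr_sumr !big_nat; apply: eq_bigr => k /andP[_ kl].
rewrite (C_split z0 gamma l0)// intrB; ring.
Qed.

Lemma S_E l : (0 < l)%N -> S_ z gamma l.*2 = C_ z gamma l.*2 l * M l ^+ 3 * T 0 l.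
Proof.
move=> l0; rewrite -sum_moment//; apply: eq_bigr => k _.
by rewrite expr0 mul1r.
Qed.

Lemma scaled_momentE m l : (0 < l)%N -> scaled_moment m z gamma l.*2 = T m l / T 0 l.
Proof.
move=> l0; rewrite /scaled_moment sum_moment// S_E//.
have a0 : C_ z gamma l.*2 l * M l ^+ 3 != 0.
  by rewrite gt_eqF// mulr_gt0 ?C_center_gt0// exprn_gt0// M0.
by rewrite mul1r invfM mulrACA mulVf// mul1r mulrC.
Qed.

(** The reflection k -> n - k preserves C_ and changes the sign of (k - n/2)^m. *)
Lemma scaled_moment_odd m n : odd m -> (0 < n)%N -> ~~ odd n ->
  scaled_moment m z gamma n = 0.
Proof.
move=> mo n0 en; rewrite -(even_halfK en); set l := n./2.
have l0 : (0 < l)%N by rewrite -double_gt0 even_halfK.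
rewrite /scaled_moment; set X := \sum_(0 <= k < _) (_ ^+ m * _).
suff : X = - X by move=> h; rewrite (_ : X = 0) ?mulr0//; lra.
rewrite {1}/X big_nat_rev /X -sumrN !big_nat; apply: eq_bigr => k /andP[_ kl].
rewrite add0n subSS C_sym// /kappa doubleK natrB//.
have -> : l.*2%:R - k%:R - l%:R = - (k%:R - l%:R) :> R.
  by rewrite -mul2n natrM; ring.
by rewrite mulNr exprNn -signr_odd mo expr1 !mulN1r mulNr.
Qed.

Lemma S_equiv_center :
  (fun n => S_ z gamma n) ~_even_oo
  (fun n => C_ z gamma n (kappa n) * n%:R `^ (3 / 4) * mu_ 0 z gamma).
Proof.
have m0 : mu_ 0 z gamma != 0 by rewrite gt_eqF// mu0_gt0.
have g0 l : (0 < l)%N -> C_ z gamma l.*2 (kappa l.*2) * l.*2%:R `^ (3 / 4) != 0.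
  move=> l0; rewrite /kappa doubleK -root4_powR.
  by rewrite gt_eqF// mulr_gt0 ?C_center_gt0// exprn_gt0// M0.
apply: equiv_even_oo => [l l0|]; first by rewrite mulf_neq0// g0.
have h : T 0 l / mu_ 0 z gamma @[l --> \oo] --> mu_ 0 z gamma / mu_ 0 z gamma.
  by apply: cvgM; [exact: cvgT|exact: cvg_cst].
rewrite divff// in h; apply: cvg_trans h; apply: near_eq_cvg; near=> l.
have l0 : (0 < l)%N by near: l; exact: nbhs_infty_gt.
have := g0 l l0; rewrite S_E// /kappa doubleK -root4_powR /M => a0.
by rewrite invfM mulrACA divff// mul1r.
Unshelve. all: by end_near. Qed.

Lemma S_equiv_explicit :
  (fun n => S_ z gamma n) ~_even_oo
  (fun n => dfun z * mu_ 0 z gamma * n%:R `^ (1 / 4) *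
     expR (n%:R * Hfun z - u_ z gamma n * n%:R / 4)).
Proof.
have m0 : mu_ 0 z gamma != 0 by rewrite gt_eqF// mu0_gt0.
have d0 : dfun z != 0.
  rewrite dfunE// invr_eq0 gt_eqF// sqrtr_gt0 divr_gt0 ?pi_gt0//.
  by rewrite divr_gt0// addr_gt0// Afun_gt0.
apply: equiv_even_oo => [l l0|].
  rewrite -[1 / 4]/(1%:R / 4) -root4_powR expr1.
  by rewrite !mulf_neq0// gt_eqF// ?expR_gt0//; exact: M0.
have h : (gbinom (r_ z l.*2) l.*2 l * root4 R l ^+ 2 / expR (l.*2%:R * Hfun z))
   / dfun z * (T 0 l / mu_ 0 z gamma) @[l --> \oo] -->
   dfun z / dfun z * (mu_ 0 z gamma / mu_ 0 z gamma).
  apply: cvgM; apply: cvgM; try exact: cvg_cst.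
    exact: cvg_central_gbinom.
  exact: cvgT.
rewrite !divff// mul1r in h; apply: cvg_trans h; apply: near_eq_cvg; near=> l.
have l0 : (0 < l)%N by near: l; exact: nbhs_infty_gt.
rewrite S_E// C_center// -[1 / 4]/(1%:R / 4) -root4_powR expRD /M.
have := M0 l0; rewrite /M; have := expR_gt0 (l.*2%:R * Hfun z).
have := expR_gt0 (- (u_ z gamma l.*2 * l.*2%:R / 4)).
move: (expR _) (expR _) (root4 R l) (T 0 l) (gbinom _ _ _) => a b c t g a0 b0 c1.
by field; rewrite m0 d0 !gt_eqF.
Unshelve. all: by end_near. Qed.

Lemma cvg_scaled_moment m :
  scaled_moment m z gamma n @[n --> even_oo] --> mu_ m z gamma / mu_ 0 z gamma.
Proof.
have m0 : mu_ 0 z gamma != 0 by rewrite gt_eqF// mu0_gt0.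
apply: cvg_even_oo.
have h : T m l / T 0 l @[l --> \oo] --> mu_ m z gamma / mu_ 0 z gamma.
  by apply: cvgM; [exact: cvgT|apply: cvgV => //; exact: cvgT].
apply: cvg_trans h; apply: near_eq_cvg; near=> l.
by rewrite scaled_momentE//; near: l; exact: nbhs_infty_gt.
Unshelve. all: by end_near. Qed.

End Assembly.

Theorem theorem3p4 (R : realType) (z gamma : R) (hz : 0 < z) :
  [/\ (fun n : nat => S_ z gamma n) ~_even_oo
        (fun n : nat =>
           C_ z gamma n (kappa n) * n%:R `^ (3 / 4) * mu_ 0 z gamma),
      (fun n : nat => S_ z gamma n) ~_even_oo
        (fun n : nat =>
           dfun z * mu_ 0 z gamma * n%:R `^ (1 / 4) *
           expR (n%:R * Hfun z - u_ z gamma n * n%:R / 4)),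
      forall m : nat,
        scaled_moment m z gamma n @[n --> even_oo] -->
          mu_ m z gamma / mu_ 0 z gamma
    & forall m n : nat, odd m -> (0 < n)%N -> ~~ odd n ->
        scaled_moment m z gamma n = 0].
Proof.
split.
- exact: S_equiv_center.
- exact: S_equiv_explicit.
- by move=> m; exact: cvg_scaled_moment.
- by move=> m n; exact: scaled_moment_odd.
Qed.
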